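(* Let $(X_1,d_1)$ and $(X_2,d_2)$ be proper geodesic hyperbolic metric spaces. For $i=1,2$ let $u_i\in\partial X_i$ and let $B_i:X_i\to\mathbb{R}$ be a Busemann function on $X_i$ associated to a geodesic ray in $X_i$ converging to $u_i$. Let $$Y=(X_1,B_1)\times_h(X_2,B_2):=\{(x_1,x_2)\in X_1\times X_2\mid B_1(x_1)=B_2(x_2)\},$$ equipped with the interior metric $d$ on $Y$ induced by the Euclidean product metric $d_e$. Then $(Y,d)$ is also a proper geodesic hyperbolic metric space, and its boundary at infinity $\partial Y$ is naturally homeomorphic to the smashed product $\partial X_1\wedge\partial X_2$ of the pointed spaces $(\partial X_1,u_1)$ and $(\partial X_2,u_2)$.
   Context: A metric space $(X,d)$ is geodesic if any two points $x,y$ can be joined by a geodesic segment, i.e. the image of a path from $x$ to $y$ parameterized by arclength on $[0,d(x,y)]$ which is an isometric embedding. It is proper if closed balls are compact. A geodesic metric space is $\delta$-hyperbolic if for every triangle with geodesic sides each side is contained in the $\delta$-neighborhood of the union of the other two sides; it is hyperbolic if it is $\delta$-hyperbolic for some $\delta\ge 0$. The Euclidean product metric on $X_1\times X_2$ is $d_e((x_1,x_2),(y_1,y_2))=\big(d_1(x_1,y_1)^2+d_2(x_2,y_2)^2\big)^{1/2}$. The interior metric on $Y$ is $d(x,y):=\inf\{L(c)\mid c \text{ a curve in } Y \text{ connecting } x \text{ to } y\}$, where $L(c)$ is the length of $c$ in $(Y,d_e)$. Boundary at infinity: for a hyperbolic space $(X,d)$ and $x,y,z\in X$ put $(x\cdot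 y)_z=\frac12[d(x,z)+d(y,z)-d(x,y)]$. Fix a basepoint $z\in X$. A sequence $\{x^k\}$ in $X$ converges to infinity if $\liminf_{k,l\to\infty}(x^k\cdot x^l)_z=\infty$. Two sequences $\{x^k\},\{y^k\}$ converging to infinity are equivalent if $\liminf_{k,l\to\infty}(x^k\cdot y^l)_z=\infty$. $\partial X$ is the set of equivalence classes $[\{x^k\}]$, with the topology generated by the sets $U(v,r)$, $v\in\partial X$, $r>0$, where $U(v,r)$ is the set of $w\in\partial X$ for which there exist $\{x^k\},\{y^k\}$ with $[\{x^k\}]=v$, $[\{y^k\}]=w$ and $\liminf_{k,l\to\infty}(x^k\cdot y^l)_z\ge r$. Busemann functions: a geodesic ray $\rho:[0,\infty)\to X$ (parameterized by arclength) converges to $u\in\partial X$ if $[\{\rho(k)\}]=u$. The Busemann function associated to $\rho$ is $B(x):=\lim_{t\to\infty}\big(d(x,\rho(t))-t\big)$. Smashed product: for pointed topological spaces $(U_1,u_1),(U_2,u_2)$, $U_1\wedge U_2$ is the quotient space of $U_1\times U_2$ obtained by collapsing $(\{u_1\}\times U_2)\cup(U_1\times\{u_2\})$ to a point. The word ''naturally'' is not given a separate formal definition; the formal content is the existence of the homeomorphism. *)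

(* Defs.v *)
From HB Require Import structures.
From mathcomp Require Import all_boot all_order all_algebra generic_quotient.
From mathcomp Require Import all_classical all_reals all_analysis.
Import numFieldNormedType.Exports.
Import Order.TTheory GRing.Theory Num.Theory.

Set Implicit Arguments.
Unset Strict Implicit.
Unset Printing Implicit Defensive.

Local Open Scope classical_set_scope.
Local Open Scope ring_scope.

Section metric_notions.
Context {R : realType} (X : metricType R).
Implicit Types (x y z : X) (A B C : set X).

Definition geodesic_path x y (g : R -> X) : Prop :=
  [/\ g 0 = x, g (mdist x y) = y &
      forall s t, s \in `[0, mdist x y] -> t \in `[0, mdist x y] ->
        mdist (g s) (g t) = `|s - t|].

Definition geodesic_segment x y A : Prop :=
  exists2 g, geodesic_path x y g & A = g @` `[0, mdist x y].

Definition geodesic_space : Prop := forall x y, exists A, geodesic_segment x y A.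

(* Not the library's [closed_ball], which is the closure of the open ball. *)
Definition proper_space : Prop :=
  forall x (r : R), compact [set y | mdist x y <= r].

(* A non-strict inequality, so that delta = 0 is meaningful (real trees). *)
Definition neighborhood (delta : R) A : set X :=
  [set x | exists2 y, A y & mdist x y <= delta].

Definition delta_hyperbolic (delta : R) : Prop :=
  forall x y z A B C,
    geodesic_segment x y A -> geodesic_segment y z B -> geodesic_segment z x C ->
    [/\ A `<=` neighborhood delta (B `|` C),
        B `<=` neighborhood delta (C `|` A) &
        C `<=` neighborhood delta (A `|` B)].

Definition hyperbolic_space : Prop :=
  exists2 delta : R, 0 <= delta & delta_hyperbolic delta.

Definition proper_geodesic_hyperbolic : Prop :=
  [/\ proper_space, geodesic_space & hyperbolic_space].

Definition gromov_product z x y : R :=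
  2^-1 * (mdist x z + mdist y z - mdist x y).

Definition liminf_gromov z (x y : nat -> X) : \bar R :=
  limf_einf (fun kl : nat * nat => (gromov_product z (x kl.1) (y kl.2))%:E)
    (filter_prod \oo \oo).

Definition converges_to_infinity z (x : nat -> X) : Prop :=
  liminf_gromov z x x = +oo%E.

Definition equivalent_at_infinity z (x y : nat -> X) : Prop :=
  liminf_gromov z x y = +oo%E.

Definition class_at_infinity z (x : nat -> X) : set (nat -> X) :=
  [set y | converges_to_infinity z y /\ equivalent_at_infinity z x y].

Definition geodesic_ray (rho : R -> X) : Prop :=
  forall s t, 0 <= s -> 0 <= t -> mdist (rho s) (rho t) = `|s - t|.

End metric_notions.

(* The boundary as the set of equivalence classes, rather than a [quotType]:
   the relation is only known to be transitive when X is hyperbolic. *)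
Definition boundary {R : realType} {X : metricType R} (z : X) : Type :=
  set_type [set A : set (nat -> X) |
    exists2 x, converges_to_infinity z x & A = class_at_infinity z x].

HB.instance Definition _ (R : realType) (X : metricType R) (z : X) :=
  Choice.on (boundary z).

Section boundary_topology.
Context {R : realType} {X : metricType R} (z : X).
Implicit Types (v w : boundary z) (W : set (boundary z)).

Definition represents (x : nat -> X) v : Prop :=
  converges_to_infinity z x /\ class_at_infinity z x = \val v.

Definition boundary_nbhd v (r : R) : set (boundary z) :=
  [set w | exists x y, [/\ represents x v, represents y w &
                           (r%:E <= liminf_gromov z x y)%E]].

(* The sets [boundary_nbhd v r], r > 0, generate the neighbourhoods of v. They
   need not be open themselves and must not be taken as an open subbasis: in the
   hyperbolic plane they are closed arcs centred at v, and two of these can meet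
   in one point, so that such a subbasis would make the circle discrete. *)
Definition boundary_open W : Prop :=
  forall v, W v -> exists2 r : R, 0 < r & boundary_nbhd v r `<=` W.

Lemma boundary_nbhd_le v (r s : R) :
  r <= s -> boundary_nbhd v s `<=` boundary_nbhd v r.
Proof.
move=> rs w [x [y [xv yw sxy]]]; exists x, y; split => //.
by apply: le_trans sxy; rewrite lee_fin.
Qed.

Lemma boundary_openT : boundary_open setT.
Proof. by move=> v _; exists 1. Qed.

Lemma boundary_openI : setI_closed boundary_open.
Proof.
move=> W1 W2 o1 o2 v [/o1[r r0 rW1] /o2[s s0 sW2]].
exists (Num.max r s); first by rewrite lt_max r0.
move=> w vw; split; [apply: rW1|apply: sW2]; apply: boundary_nbhd_le vw.
  by rewrite le_max lexx.
by rewrite le_max lexx orbT.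
Qed.

Lemma boundary_open_bigcup (I : Type) (W : I -> set (boundary z)) :
  (forall i, boundary_open (W i)) -> boundary_open (\bigcup_i W i).
Proof.
move=> oW v [i _ /oW[r r0 rW]]; exists r => // w /rW Wiw.
by exists i.
Qed.

HB.instance Definition _ := isOpenTopological.Build (boundary z)
  boundary_openT boundary_openI boundary_open_bigcup.

Definition busemann_function (u : boundary z) (B : X -> R) : Prop :=
  exists rho : R -> X,
    [/\ geodesic_ray rho, represents (fun k => rho k%:R) u &
        forall x, mdist x (rho t) - t @[t --> +oo] --> B x].

End boundary_topology.

Section product.
Context {R : realType} {X1 X2 : metricType R}.
Implicit Types (p q : X1 * X2) (Y : set (X1 * X2)) (c : R -> X1 * X2).

Definition euclidean_dist p q : R :=
  Num.sqrt (mdist p.1 q.1 ^+ 2 + mdist p.2 q.2 ^+ 2).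

(* Same shape as the library's [variation] and [total_variation], which are
   restricted to real-valued functions. *)
Definition polygonal_length (a b : R) c (s : seq R) : R :=
  let F := c \o nth b (a :: s) in
  \sum_(0 <= n < size s) euclidean_dist (F n) (F n.+1).

Definition curve_length (a b : R) c : \bar R :=
  ereal_sup [set (polygonal_length a b c s)%:E | s in itv_partition a b].

(* Continuity is for the library's product topology, which is the topology of
   [euclidean_dist]. *)
Definition curve_in Y p q c : Prop :=
  [/\ {within `[0, 1], continuous c}, c @` `[0, 1] `<=` Y, c 0 = p & c 1 = q].

(* Equal to +oo when no rectifiable curve in Y joins p to q. *)
Definition interior_dist Y p q : \bar R :=
  ereal_inf [set curve_length 0 1 c | c in curve_in Y p q].

Definition horospherical_product (B1 : X1 -> R) (B2 : X2 -> R) : set (X1 * X2) :=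
  [set p | B1 p.1 = B2 p.2].

(* M is the set Y equipped with its interior metric, which is thereby finite and
   a metric; f is the identification of the points of M with those of Y. *)
Definition interior_metric_space Y (M : metricType R) (f : M -> X1 * X2) : Prop :=
  set_bij setT Y f /\
  forall a b : M, (mdist a b)%:E = interior_dist Y (f a) (f b).

End product.

Section smash.
Context {U1 U2 : topologicalType} (u1 : U1) (u2 : U2).

Definition smash_base (a : U1 * U2) : bool := (a.1 == u1) || (a.2 == u2).

Let smash_rel' (a b : U1 * U2) : bool :=
  (a == b) || (smash_base a && smash_base b).

Let smash_rel_refl : reflexive smash_rel'.
Proof. by move=> a; rewrite /smash_rel' eqxx. Qed.

Let smash_rel_sym : symmetric smash_rel'.
Proof. by move=> a b; rewrite /smash_rel' eq_sym andbC. Qed.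

Let smash_rel_trans : transitive smash_rel'.
Proof.
move=> b a c /predU1P[-> //|/andP[ha hb]] /predU1P[<-|/andP[_ hc]].
  by rewrite /smash_rel' ha hb orbT.
by rewrite /smash_rel' ha hc orbT.
Qed.

Definition smash_rel :=
  EquivRel smash_rel' smash_rel_refl smash_rel_sym smash_rel_trans.

Local Open Scope quotient_scope.

Definition smash := quotient_topology {eq_quot smash_rel}.

HB.instance Definition _ := Topological.on smash.
HB.instance Definition _ := Quotient.on smash.

End smash.

Definition homeomorphism {T U : topologicalType} (h : T -> U) : Prop :=
  continuous h /\ exists g : U -> T, [/\ cancel h g, cancel g h & continuous g].

(* Main.v *)
Require Import Defs.
From HB Require Import structures.
From mathcomp Require Import all_boot all_order all_algebra generic_quotient.
From mathcomp Require Import all_classical all_reals all_analysis.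
From mathcomp Require Import ring lra.
Import numFieldNormedType.Exports.
Import Order.TTheory GRing.Theory Num.Theory.
Local Open Scope classical_set_scope.
Local Open Scope ring_scope.

Set Implicit Arguments.
Unset Strict Implicit.
Unset Printing Implicit Defensive.

(* Write (x|y)_B = (B x + B y - d(x,y)) / 2 for the Gromov product based at the
   centre of a Busemann function B; it is a quasi-ultrametric, and from every point
   one can move towards the centre along a geodesic on which B has slope -1.
   In Y such a vertical motion takes place in both factors at once, hence costs
   sqrt 2 per unit of height. Going up to the height min((x1|y1)_B1, (x2|y2)_B2),
   crossing there at bounded cost and going down again gives an upper bound for
   d_Y. Conversely, along a geodesic of Y the height B grows linearly on both sides
   of the middle, so the ultrametric inequality along equidistant points bounds
   (x_i|y_i)_Bi below. Thus sqrt 2 B is a Lipschitz function on Y with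
     (p|q)_(sqrt 2 B) = sqrt 2 min((x1|y1)_B1, (x2|y2)_B2) + O(1),
   which is a quasi-ultrametric; since its values determine the differences in the
   four-point condition, Y is hyperbolic. Off the centre omega of sqrt 2 B, a
   sequence of Y converges to infinity iff both of its components do, away from u1
   and u2. This gives a continuous surjection from the product of the boundaries,
   which is compact, to the boundary of Y, which is Hausdorff, collapsing exactly
   the points with a coordinate u_i to omega: it is a quotient map. *)

(** * Gromov hyperbolicity *)

(** Nothing is known beforehand about the interior metric: it is an infimum over curves, possibly
    infinite, possibly with a finer topology than [euclidean_dist]. The detour upwards settles both
    points: carried out up to the merging height it makes the metric finite, and carried out up to a
    small height it shows that convergence of both coordinates implies convergence in Y. Properness
    and geodesics then come from ultralimits of points, taken separately for each parameter value.
    Products based at the centre are the right ones to compare because they are heights, and height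
    is what the two factors share. Boundaries, however, are defined with a basepoint z. If c(a)
    denotes the product of a and the centre based at z, then (a|b)_z = (a|b)_B + c(a) + c(b) - B z.
    So the two kinds of product tend to infinity together on sequences where c stays bounded, and a
    sequence converging to infinity either has bounded c or converges to the centre. This dichotomy
    is what forces the collapsed point omega to be treated apart. *)

Section ultralimits.
Context {R : realType}.

Lemma ultra_fmap (I T : Type) (U : set_system I) (f : I -> T) :
  UltraFilter U -> UltraFilter (f @ U).
Proof.
move=> UU; split; first exact: fmap_proper_filter.
move=> G GG UG; rewrite predeqE => A; split; last exact: UG.
move=> GA; have [//|UnA] := in_ultra_setVsetC (f @^-1` A) UU.
have {}UnA : G (~` A) by apply: UG; rewrite /fmap/= preimage_setC.
by have /filter_ex[? []] : G (A `&` ~` A) by exact: filterI.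
Qed.

(** This plays the role of Arzela-Ascoli: applied at each parameter value of a family of paths, it
    gives a pointwise limit path along one fixed ultrafilter, without extracting subsequences. *)
Lemma ultra_limit (X : metricType R) (hX : proper_space X) (I : Type)
    (U : set_system I) (UU : UltraFilter U) (g : I -> X) (x0 : X) (r : R) :
  (\forall i \near U, mdist x0 (g i) <= r) ->
  exists x, forall e, 0 < e -> \forall i \near U, mdist x (g i) < e.
Proof.
move=> gr; have := hX x0 r; rewrite compact_ultra => /(_ (g @ U)).
have GU := ultra_fmap g UU.
case=> // x [_ gx]; exists x => e e0.
by have /gx := nbhsx_ballx x e e0; rewrite ballEmdist.
Qed.

End ultralimits.

Section gromov_hyperbolicity.
Context {R : realType}.

(* [f x z >= min (f x y) (f y z) - D], in the form of a disjunction. *)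
Definition quasi_ultrametric (T : Type) (D : R) (f : T -> T -> R) : Prop :=
  forall x y z, f x y - D <= f x z \/ f y z - D <= f x z.

Context (X : metricType R).
Implicit Types (w x y z : X) (A B C : set X).

Definition gromov_hyperbolic (D : R) : Prop :=
  forall w, quasi_ultrametric D (gromov_product w).

Lemma gromov_productC z x y : gromov_product z x y = gromov_product z y x.
Proof. by rewrite /gromov_product (metric_sym x y); lra. Qed.

Lemma geodesic_pathP x y g :
  geodesic_path x y g -> forall s t, 0 <= s <= mdist x y -> 0 <= t <= mdist x y ->
  mdist (g s) (g t) = `|s - t|.
Proof. by case=> _ _ gi s t sL tL; apply: gi; rewrite in_itv. Qed.

Lemma geodesic_path0 x y g s :
  geodesic_path x y g -> 0 <= s <= mdist x y -> mdist x (g s) = s.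
Proof.
move=> gg s0; have [g0 _ _] := gg.
rewrite -[in LHS]g0 (geodesic_pathP gg) ?lexx ?mdist_ge0//.
by rewrite sub0r normrN ger0_norm//; case/andP: s0.
Qed.

Lemma geodesic_path1 x y g s :
  geodesic_path x y g -> 0 <= s <= mdist x y -> mdist (g s) y = mdist x y - s.
Proof.
move=> gg s0; have [_ g1 _] := gg.
rewrite -[in LHS]g1 (geodesic_pathP gg) ?lexx ?mdist_ge0//.
by rewrite distrC ger0_norm// subr_ge0; case/andP: s0.
Qed.

Lemma geodesic_exists x y : geodesic_space X -> exists g, geodesic_path x y g.
Proof. by move=> /(_ x y)[A [g gg _]]; exists g. Qed.

Lemma geodesic_segment_sum x y A w :
  geodesic_segment x y A -> A w -> mdist x w + mdist w y = mdist x y.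
Proof.
move=> [g gg ->] [s /=]; rewrite in_itv/= => sL <-.
by rewrite (geodesic_path0 gg)// (geodesic_path1 gg)//; lra.
Qed.

Lemma geodesic_segmentP x y A s : geodesic_segment x y A ->
  0 <= s <= mdist x y -> exists2 w, A w & mdist x w = s /\ mdist w y = mdist x y - s.
Proof.
move=> [g gg ->] sL; exists (g s); first by exists s => //=; rewrite in_itv.
by split; [exact: geodesic_path0 gg _|exact: geodesic_path1 gg _].
Qed.

(** Near the last parameter at which [A] is [d]-close to [C], it must become [d]-close to [B], or
    the endpoint [y] of [B] is reached. The supremum may not be attained, whence the slack 1. *)
Lemma delta_hyperbolic_center (d : R) x y z A B C :
  0 <= d -> delta_hyperbolic X d ->
  geodesic_segment x y A -> geodesic_segment y z B -> geodesic_segment z x C ->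
  exists2 w, A w & (exists2 b, B b & mdist w b <= d + 1) /\
                   (exists2 c, C c & mdist w c <= d + 1).
Proof.
move=> d0 hX hA hB hC; have [AN _ _] := hX _ _ _ _ _ _ hA hB hC.
have [g gg Ag] := hA.
have Cx : C x.
  have [h hh ->] := hC; have [_ h1 _] := hh.
  by exists (mdist z x) => //=; rewrite in_itv/= mdist_ge0 lexx.
have By : B y.
  have [h hh ->] := hB; have [h0 _ _] := hh.
  by exists 0 => //=; rewrite in_itv/= mdist_ge0 lexx.
pose L := mdist x y.
have L0 : 0 <= L by exact: mdist_ge0.
pose S := [set s | 0 <= s <= L /\ exists2 c, C c & mdist (g s) c <= d].
have S0 : S 0.
  split; first by rewrite lexx.
  by exists x => //; have [-> _ _] := gg; rewrite mdistxx.
have hS : has_sup S.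
  by split; [exists 0|exists L => s [/andP[]]].
have /andP[m0 mL] : 0 <= sup S <= L.
  by rewrite (ub_le_sup _ S0) ?ge_sup ?hS//; [exists 0|move=> s [/andP[]]|case: hS].
(* The parameter [s] is in [S] and [s + 2^-1] is beyond its supremum; the two points of the side are
   1/2 apart. *)
have [|s [sL [c Cc sc]] ms] := @sup_adherent _ S 2^-1 _ hS; first by lra.
have sC : exists2 c, C c & mdist (g s) c <= d + 1 by exists c => //; lra.
exists (g s); first by rewrite Ag; exists s => //=; rewrite in_itv.
split=> //; have [Ls|sL2] := leP L (s + 2^-1).
  exists y => //; rewrite (geodesic_path1 gg)//.
  by have -> : mdist x y = L by []; lra.
have s'L : 0 <= s + 2^-1 <= L by move: sL; lra.
have nS : ~ S (s + 2^-1).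
  by move=> /(ub_le_sup hS.2); lra.
have /AN[b [Bb|Cb] gb] : A (g (s + 2^-1)).
- by rewrite Ag; exists (s + 2^-1) => //=; rewrite in_itv.
- exists b => //; have := metric_triangle (g s) (g (s + 2^-1)) b.
  rewrite (geodesic_pathP gg sL s'L) => tr.
  have : `|s - (s + 2^-1)| = 2^-1 by rewrite opprD addrA subrr sub0r normrN ger0_norm//; lra.
  by lra.
- by case: nS; split => //; exists b.
Qed.

Lemma gromov_product_le_dist x y z w :
  mdist x w + mdist w y = mdist x y -> gromov_product z x y <= mdist z w.
Proof.
move=> xwy; have := metric_triangle x w z; have := metric_triangle y w z.
rewrite /gromov_product -xwy (metric_sym w z) (metric_sym y w); lra.
Qed.

(** The centre [w] of the triangle x, y, z satisfies d(z,w) <= (x|y)_z + 2 (d + 1). In the triangle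
    x, y, v it is [d]-close to a point of one of the other sides, and the Gromov product of the ends
    of that side is at most the distance from z to this point. *)
Lemma delta_hyperbolic_gromov (d : R) : 0 <= d -> geodesic_space X ->
  delta_hyperbolic X d -> gromov_hyperbolic (d + 2 * (d + 1)).
Proof.
move=> d0 gX hX z x v y.
have [A hA] := gX x y; have [B hB] := gX y z; have [C hC] := gX z x.
have [w Aw [[b Bb wb] [c Cc wc]]] := delta_hyperbolic_center d0 hX hA hB hC.
have zw : mdist z w - 2 * (d + 1) <= gromov_product z x y.
  have := geodesic_segment_sum hA Aw.
  have := geodesic_segment_sum hB Bb; have := geodesic_segment_sum hC Cc.
  have := metric_triangle y b w; have := metric_triangle z b w.
  have := metric_triangle z c w; have := metric_triangle x c w.
  rewrite /gromov_product !(metric_sym _ x) !(metric_sym _ y) !(metric_sym _ z).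
  by rewrite !(metric_sym _ w); lra.
have [E hE] := gX y v; have [F hF] := gX v x.
have [+ _ _] := hX _ _ _ _ _ _ hA hE hF => /(_ _ Aw)[a [Ea|Fa] wa].
- right; have := gromov_product_le_dist z (geodesic_segment_sum hE Ea).
  rewrite (gromov_productC z v); have := metric_triangle z w a; lra.
- left; have := gromov_product_le_dist z (geodesic_segment_sum hF Fa).
  rewrite (gromov_productC z x v); have := metric_triangle z w a; lra.
Qed.

(** The number [s] is the Gromov product (w|z)_x. For the point [a] of the side at distance [s] from
    x, the products (x|a)_w and (a|z)_w both equal ((x|z)_w + d(a,w)) / 2, so either alternative of
    the ultrametric inequality bounds d(a,w). *)
Lemma gromov_near_side (D : R) x z A w : gromov_hyperbolic D ->
  geodesic_segment x z A -> gromov_product w x z <= D ->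
  exists2 a, A a & mdist w a <= 3 * D.
Proof.
move=> hX hA wxz; pose s := 2^-1 * (mdist x w - mdist w z + mdist x z).
have := metric_triangle x w z; have := metric_triangle x z w.
have := metric_triangle w x z; rewrite (metric_sym w x) (metric_sym z w) => t1 t2 t3.
have sL : 0 <= s <= mdist x z by rewrite /s; lra.
have [a Aa [xa az]] := geodesic_segmentP hA sL.
exists a => //; move: wxz.
have := hX w x a z; rewrite /gromov_product xa az (metric_sym a w) (metric_sym z w).
by rewrite /s; lra.
Qed.

(** A point [w] of a side has Gromov product 0 with respect to its ends, so one of the two other
    sides has product at most [D] seen from [w]. *)
Lemma gromov_delta_hyperbolic (D : R) :
  gromov_hyperbolic D -> delta_hyperbolic X (3 * D).
Proof.
move=> hX x y z A B C hA hB hC.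
have side u v t (S T V : set X) : geodesic_segment u v S ->
    geodesic_segment v t T -> geodesic_segment t u V ->
    S `<=` neighborhood (3 * D) (T `|` V).
  move=> hS hT hV w Sw; have uwv := geodesic_segment_sum hS Sw.
  have w0 : gromov_product w u v = 0 by rewrite /gromov_product (metric_sym v w); lra.
  have [h|h] := hX w u t v.
    have [|a Va wa] := @gromov_near_side D t u V w hX hV.
      by rewrite gromov_productC; lra.
    by exists a => //; right.
  have [|a Ta wa] := @gromov_near_side D v t T w hX hT.
    by rewrite gromov_productC; lra.
  by exists a => //; left.
by split; apply: side; eassumption.
Qed.

End gromov_hyperbolicity.

(** * Busemann functions *)

Section horofunctions.
Context {R : realType} (X : metricType R) (B : X -> R).
Implicit Types (w x y z : X).

(* The Gromov product of [x] and [y] based at the centre of [B]. *)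
Definition busemann_product x y : R := 2^-1 * (B x + B y - mdist x y).

Record horofunction (D : R) : Prop := Horofunction {
  horo_lip : forall x y, B x - B y <= mdist x y;
  horo_ultra : quasi_ultrametric D busemann_product }.

Definition ascending : Prop :=
  forall x s, 0 <= s -> exists2 x', mdist x x' = s & B x' = B x - s.

Lemma busemann_productC x y : busemann_product x y = busemann_product y x.
Proof. by rewrite /busemann_product (metric_sym x y); lra. Qed.

Lemma horo_lip_norm (D : R) x y : horofunction D -> `|B x - B y| <= mdist x y.
Proof.
move=> hB; rewrite ler_norml; have := horo_lip hB x y; have := horo_lip hB y x.
by rewrite (metric_sym y x); lra.
Qed.

Lemma busemann_product_le (D : R) x y : horofunction D -> busemann_product x y <= B x.
Proof. by move=> hB; rewrite /busemann_product; have := horo_lip hB y x; rewrite metric_sym; lra. Qed.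

(* In the four-point condition the terms [B] cancel. *)
Lemma horofunction_gromov (D : R) : horofunction D -> gromov_hyperbolic X (2 * D).
Proof.
move=> hB w x y z.
have := horo_ultra hB x y z; have := horo_ultra hB x w z.
have := horo_ultra hB y x w; have := horo_ultra hB y z w.
rewrite (busemann_productC y x) (busemann_productC w z).
rewrite /busemann_product /gromov_product; lra.
Qed.

Section busemann.
Context (z : X) (u : boundary z) (rho : R -> X).
Hypotheses (rhoP : geodesic_ray rho)
  (rhoB : forall x, mdist x (rho t) - t @[t --> +oo] --> B x).

Lemma busemann_near x (e : R) : 0 < e ->
  \forall t \near +oo, `|B x - (mdist x (rho t) - t)| < e.
Proof. by move=> e0; move/cvgrPdist_lt : (rhoB (x := x)); apply. Qed.

(** By the triangle inequality the right-hand side is non-increasing in [t], and [B x] is its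
    limit. *)
Lemma busemann_le x (t : R) : 0 <= t -> B x <= mdist x (rho t) - t.
Proof.
move=> t0; apply/ler_addgt0Pr => e e0.
near (pinfty_nbhs R) => s.
have ts : t <= s by near: s; apply: nbhs_pinfty_ge; rewrite num_real.
have : `|B x - (mdist x (rho s) - s)| < e by near: s; exact: busemann_near.
have := metric_triangle x (rho t) (rho s).
have s0 : 0 <= s by lra.
rewrite (rhoP t0 s0).
have -> : `|t - s| = s - t by rewrite distrC ger0_norm// subr_ge0.
by rewrite ltr_norml; lra.
Unshelve. all: by end_near. Qed.

Lemma busemann_ray (t : R) : 0 <= t -> B (rho t) = - t.
Proof.
move=> t0; apply/eqP; rewrite eq_le; apply/andP; split.
  by have := busemann_le (rho t) t0; rewrite mdistxx sub0r.
apply/ler_addgt0Pr => e e0.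
near (pinfty_nbhs R) => s.
have ts : t <= s by near: s; apply: nbhs_pinfty_ge; rewrite num_real.
have : `|B (rho t) - (mdist (rho t) (rho s) - s)| < e by near: s; exact: busemann_near.
have s0 : 0 <= s by lra.
rewrite (rhoP t0 s0).
have -> : `|t - s| = s - t by rewrite distrC ger0_norm// subr_ge0.
by rewrite ltr_norml; lra.
Unshelve. all: by end_near. Qed.

(** [busemann_product x y] is the limit of [gromov_product (rho t) x y - t], and the shift by [t] is
    the same in all terms of the ultrametric inequality. *)
Lemma busemann_horofunction (D : R) : gromov_hyperbolic X D -> horofunction D.
Proof.
move=> hX; split=> [x y|x y v].
- apply/ler_addgt0Pr => e e0; have e20 : 0 < e / 2 by lra.
  near (pinfty_nbhs R) => t.
  have : `|B x - (mdist x (rho t) - t)| < e / 2 by near: t; exact: busemann_near.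
  have : `|B y - (mdist y (rho t) - t)| < e / 2 by near: t; exact: busemann_near.
  have := metric_triangle x y (rho t).
  by rewrite !ltr_norml; lra.
- have [h1|h1] := leP (busemann_product x y - D) (busemann_product x v); first by left.
  have [h2|h2] := leP (busemann_product y v - D) (busemann_product x v); first by right.
  (* Both alternatives are supposed to fail, by the margins [a] and [b]; for large [t] the limits
     are approximated to a quarter of each margin, and both alternatives fail at [rho t] too. *)
  exfalso; pose a := busemann_product x y - D - busemann_product x v.
  pose b := busemann_product y v - D - busemann_product x v.
  have a0 : 0 < a / 4 by rewrite /a; lra.
  have b0 : 0 < b / 4 by rewrite /b; lra.
  near (pinfty_nbhs R) => t.
  have xa : `|B x - (mdist x (rho t) - t)| < a / 4 by near: t; exact: busemann_near.
  have ya : `|B y - (mdist y (rho t) - t)| < a / 4 by near: t; exact: busemann_near.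
  have va : `|B v - (mdist v (rho t) - t)| < a / 4 by near: t; exact: busemann_near.
  have xb : `|B x - (mdist x (rho t) - t)| < b / 4 by near: t; exact: busemann_near.
  have yb : `|B y - (mdist y (rho t) - t)| < b / 4 by near: t; exact: busemann_near.
  have vb : `|B v - (mdist v (rho t) - t)| < b / 4 by near: t; exact: busemann_near.
  move: xa ya va xb yb vb; rewrite !ltr_norml => xa ya va xb yb vb.
  have := hX (rho t) x y v; move: h1 h2 xa ya va xb yb vb.
  rewrite /a /b /gromov_product /busemann_product.
  by lra.
Unshelve. all: by end_near. Qed.

(** The point [x'] is a limit, as [t] grows, of the points at distance [s] from [x] on geodesics
    from [x] to [rho t]. *)
Lemma busemann_ascending (D : R) : proper_space X -> geodesic_space X ->
  gromov_hyperbolic X D -> ascending.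
Proof.
move=> pX gX hX x s s0; have hB := busemann_horofunction hX.
have /choice[p pP] (t : R) : exists y, s <= mdist x (rho t) ->
    mdist x y = s /\ mdist y (rho t) = mdist x (rho t) - s.
  have [st|_] := leP s (mdist x (rho t)); last by exists x.
  have [A hA] := gX x (rho t).
  have [|y _ yP] := @geodesic_segmentP _ _ _ _ _ s hA; first by rewrite s0.
  by exists y.
have far : \forall t \near +oo, s <= mdist x (rho t).
  near=> t.
  have : `|B x - (mdist x (rho t) - t)| < 1 by near: t; exact: busemann_near.
  have : 1 + s - B x <= t by near: t; apply: nbhs_pinfty_ge; rewrite num_real.
  by rewrite ltr_norml; lra.
have [U [UU pU]] := ultraFilterLemma (proper_pinfty_nbhs (R := R)).
have [|x' x'P] := @ultra_limit _ _ pX _ U UU p x s.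
  apply: pU; near=> t.
  by have [|-> _] := pP t => //; near: t; exact: far.
have xx' : mdist x x' <= s.
  apply/ler_addgt0Pr => e e0; near U => t.
  have st : s <= mdist x (rho t) by near: t; exact: pU.
  have : mdist x' (p t) < e by near: t; exact: x'P.
  have [px _] := pP _ st; have := metric_triangle x (p t) x'.
  by rewrite (metric_sym (p t) x'); lra.
have Bx' : B x' <= B x - s.
  apply/ler_addgt0Pr => e e0; have e2 : 0 < e / 2 by lra.
  near U => t.
  have st : s <= mdist x (rho t) by near: t; exact: pU.
  have xt : mdist x' (p t) < e / 2 by near: t; exact: x'P.
  have t0 : 0 <= t by near: t; apply: pU; apply: nbhs_pinfty_ge; rewrite num_real.
  have : `|B x - (mdist x (rho t) - t)| < e / 2.
    by near: t; apply: pU; exact: busemann_near.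
  have [_ pt] := pP _ st; have := metric_triangle x' (p t) (rho t).
  have := busemann_le x' t0.
  by rewrite ltr_norml; lra.
(* The Lipschitz bound turns [xx'] and [Bx'] into equalities. *)
have := horo_lip hB x x'.
by exists x'; lra.
Unshelve. all: by end_near. Qed.

End busemann.

End horofunctions.

(** * Rectifiable curves *)

Section euclidean_product.
Context {R : realType} {X1 X2 : metricType R}.
Implicit Types (p q r : X1 * X2).
Local Notation ed := euclidean_dist.

Lemma euclidean_dist_ge0 p q : 0 <= ed p q.
Proof. exact: sqrtr_ge0. Qed.

Lemma euclidean_dist_sqr p q : ed p q ^+ 2 = mdist p.1 q.1 ^+ 2 + mdist p.2 q.2 ^+ 2.
Proof. by rewrite sqr_sqrtr// addr_ge0// sqr_ge0. Qed.

Lemma euclidean_dist_le p q L : 0 <= L ->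
  (ed p q <= L) = (mdist p.1 q.1 ^+ 2 + mdist p.2 q.2 ^+ 2 <= L ^+ 2).
Proof.
by move=> L0; rewrite -euclidean_dist_sqr ler_pXn2r// nnegrE euclidean_dist_ge0.
Qed.

Lemma euclidean_dist_sym p q : ed p q = ed q p.
Proof. by rewrite /euclidean_dist !(metric_sym p.1) !(metric_sym p.2). Qed.

Lemma euclidean_distxx p : ed p p = 0.
Proof. by rewrite /euclidean_dist !mdistxx expr0n addr0 sqrtr0. Qed.

Lemma euclidean_dist_le_add p q : ed p q <= mdist p.1 q.1 + mdist p.2 q.2.
Proof.
have := mdist_ge0 p.1 q.1; have := mdist_ge0 p.2 q.2 => h1 h2.
by rewrite euclidean_dist_le ?addr_ge0//; nra.
Qed.

Lemma euclidean_dist_ge1 p q : mdist p.1 q.1 <= ed p q.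
Proof.
rewrite -(@ler_pXn2r _ 2) ?nnegrE ?euclidean_dist_ge0 ?mdist_ge0//.
by rewrite euclidean_dist_sqr lerDl sqr_ge0.
Qed.

Lemma euclidean_dist_ge2 p q : mdist p.2 q.2 <= ed p q.
Proof.
rewrite -(@ler_pXn2r _ 2) ?nnegrE ?euclidean_dist_ge0 ?mdist_ge0//.
by rewrite euclidean_dist_sqr lerDr sqr_ge0.
Qed.

Lemma euclidean_dist_triangle q p r : ed p r <= ed p q + ed q r.
Proof.
have p0 := euclidean_dist_ge0 p q; have q0 := euclidean_dist_ge0 q r.
have Ap := euclidean_dist_sqr p q; have Aq := euclidean_dist_sqr q r.
rewrite euclidean_dist_le ?addr_ge0//.
have := metric_triangle p.1 q.1 r.1; have := metric_triangle p.2 q.2 r.2.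
have := mdist_ge0 p.1 q.1; have := mdist_ge0 p.2 q.2.
have := mdist_ge0 q.1 r.1; have := mdist_ge0 q.2 r.2.
have := mdist_ge0 p.1 r.1; have := mdist_ge0 p.2 r.2.
move: p0 q0 Ap Aq.
move: (ed p q) (ed q r) (mdist p.1 q.1) (mdist p.2 q.2) (mdist q.1 r.1) (mdist q.2 r.2).
move: (mdist p.1 r.1) (mdist p.2 r.2) => a b A B a1 b1 a2 b2 A0 B0 EA EB.
move=> b0 a0 b20 a20 b10 a10 hb ha.
have CS : a1 * a2 + b1 * b2 <= A * B.
  rewrite -(@ler_pXn2r _ 2) ?nnegrE ?addr_ge0 ?mulr_ge0//.
  by rewrite exprMn EA EB; have := sqr_ge0 (a1 * b2 - a2 * b1); nra.
have : a ^+ 2 <= (a1 + a2) ^+ 2 by rewrite ler_pXn2r// nnegrE addr_ge0.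
have : b ^+ 2 <= (b1 + b2) ^+ 2 by rewrite ler_pXn2r// nnegrE addr_ge0.
by nra.
Qed.

End euclidean_product.

Section rectifiable_curves.
Context {R : realType} {X1 X2 : metricType R} (Y : set (X1 * X2)).
Implicit Types (p q r : X1 * X2) (c : R -> X1 * X2) (a b e s t L : R).
Local Notation ed := euclidean_dist.

Definition continuous_at01 c s := forall e, 0 < e -> exists2 d : R, 0 < d &
  forall t, 0 <= t <= 1 -> `|s - t| < d -> ed (c s) (c t) < e.

Lemma within01_continuousP c : {within `[0, 1], continuous c} <->
  forall s, 0 <= s <= 1 -> continuous_at01 c s.
Proof.
rewrite subspace_continuousP; split=> [hc s s01 e e0|hc s s01 W].
- have /hc cs : `[0, 1]%classic s by rewrite /= in_itv.
  have e2 : 0 < e / 2 by lra.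
  have := cs _ (nbhsx_ballx (c s) _ e2).
  rewrite /= /nbhs/= /fmap/= /within/= => /nbhs_ballP[d /= d0 hd].
  exists d => // t t01 st.
  have [] : ball (c s) (e / 2) (c t) by apply: hd => //; rewrite in_itv.
  rewrite !ballEmdist/=.
  by have := euclidean_dist_le_add (c s) (c t); lra.
- move: s01; rewrite /= in_itv/= => s01 /nbhs_ballP[e /= e0 eW].
  have [d d0 hd] := hc s s01 e e0.
  apply/nbhs_ballP; exists d => //= t st; rewrite in_itv/= => t01.
  apply: eW; have := hd t t01 st.
  have := euclidean_dist_ge1 (c s) (c t); have := euclidean_dist_ge2 (c s) (c t).
  by split; rewrite ballEmdist/=; lra.
Qed.

(* [l] plays the role of the length of [c] on [0, t]; only its increments
   matter. *)
Definition joined p q L := exists c (l : R -> R), [/\ curve_in Y p q c,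
  forall s t, 0 <= s -> s <= t -> t <= 1 -> ed (c s) (c t) <= l t - l s &
  l 1 - l 0 <= L].

Lemma joined_le p q L L' : joined p q L -> L <= L' -> joined p q L'.
Proof. by move=> [c [l [? ? lL]]] LL'; exists c, l; split => //; lra. Qed.

Lemma joined_euclidean p q L : joined p q L -> ed p q <= L.
Proof.
move=> [c [l [[_ _ <- <-] cl lL]]]; apply: le_trans lL; exact: cl.
Qed.

Lemma joinedxx p : Y p -> joined p p 0.
Proof.
move=> Yp; exists (fun=> p), (fun=> 0); split; last by lra.
  split=> //; last by move=> _ [? _ <-].
  by apply/within01_continuousP => s _ e e0; exists 1 => // t _ _; rewrite euclidean_distxx.
by move=> *; rewrite euclidean_distxx; lra.
Qed.

Lemma joined_sym p q L : joined p q L -> joined q p L.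
Proof.
move=> [c [l [[cc cY c0 c1] cl lL]]].
exists (fun t => c (1 - t)), (fun t => - l (1 - t)); split.
- split; rewrite ?subr0 ?subrr//.
  + apply/within01_continuousP => s s01 e e0.
    have [|d d0 hd] := (within01_continuousP c).1 cc (1 - s) _ e e0; first by lra.
    exists d; first by [].
    move=> t t01 st; apply: hd; first by lra.
    by rewrite (_ : 1 - s - (1 - t) = - (s - t)) ?normrN//; lra.
  + move=> y [t /=]; rewrite in_itv/= => t01 <-; apply: cY.
    by exists (1 - t) => //=; rewrite in_itv/=; lra.
- move=> s t s0 st t1; rewrite euclidean_dist_sym.
  by apply: le_trans (cl (1 - t) (1 - s) _ _ _) _; lra.
- by rewrite subr0 subrr; lra.
Qed.

Lemma joined_trans q p r L L' :
  joined p q L -> joined q r L' -> joined p r (L + L').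
Proof.
move=> [c [l [[cc cY c0 c1] cl lL]]] [c' [l' [[cc' cY' c0' c1'] cl' lL']]].
pose C t := if t <= 2^-1 then c (2 * t) else c' (2 * t - 1).
(* The constant [l 1 - l' 0] makes the two length functions agree at the junction. *)
pose l2 t := if t <= 2^-1 then l (2 * t) else l' (2 * t - 1) + (l 1 - l' 0).
have Ch : C 2^-1 = q by rewrite /C lexx divff ?pnatr_eq0.
have lh : l2 2^-1 = l 1 by rewrite /l2 lexx divff ?pnatr_eq0.
have left s t : 0 <= s -> s <= t -> t <= 2^-1 -> ed (C s) (C t) <= l2 t - l2 s.
  by move=> s0 st t2; rewrite /C /l2 t2 (le_trans st t2); apply: cl; lra.
have right s t : 2^-1 <= s -> s <= t -> t <= 1 -> ed (C s) (C t) <= l2 t - l2 s.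
  have rC u : 2^-1 <= u -> C u = c' (2 * u - 1) /\ l2 u = l' (2 * u - 1) + (l 1 - l' 0).
    rewrite le_eqVlt => /predU1P[<-|hu].
      by rewrite Ch lh divff ?pnatr_eq0// subrr c0'; split=> //; lra.
    by rewrite /C /l2 leNgt hu.
  move=> hs st t1; have [|-> ->] := rC s; first by lra.
  have [|-> ->] := rC t; first by lra.
  by apply: le_trans (cl' (2 * s - 1) (2 * t - 1) _ _ _) _; lra.
exists C, l2; split.
- split.
  + apply/within01_continuousP => s s01 e e0.
    have [sh|sh|sh] := ltgtP s 2^-1.
    * have [|d d0 hd] := (within01_continuousP c).1 cc (2 * s) _ e e0; first by lra.
      exists (Num.min (d / 2) (2^-1 - s)); first by rewrite lt_min; lra.
      move=> t t01; rewrite lt_min !ltr_norml => st.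
      have th : t <= 2^-1 by lra.
      rewrite /C (ltW sh) th; apply: hd; first by lra.
      by rewrite ltr_norml; lra.
    * have [|d d0 hd] := (within01_continuousP c').1 cc' (2 * s - 1) _ e e0; first by lra.
      exists (Num.min (d / 2) (s - 2^-1)); first by rewrite lt_min; lra.
      move=> t t01; rewrite lt_min !ltr_norml => st.
      have th : 2^-1 < t by lra.
      rewrite /C leNgt sh leNgt th/=; apply: hd; first by lra.
      by rewrite ltr_norml; lra.
    * have [|d d0 hd] := (within01_continuousP c).1 cc 1 _ e e0; first by lra.
      have [|d' d'0 hd'] := (within01_continuousP c').1 cc' 0 _ e e0; first by lra.
      exists (Num.min (d / 2) (d' / 2)); first by rewrite lt_min; lra.
      move=> t t01; rewrite lt_min !ltr_norml sh Ch => st.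
      rewrite /C; case: ifPn => [th|]; last rewrite -ltNge => th.
        by rewrite -c1; apply: hd; rewrite ?ltr_norml; lra.
      by rewrite -c0'; apply: hd'; rewrite ?ltr_norml; lra.
  + move=> y [t /=]; rewrite in_itv/= => t01 <-.
    rewrite /C; case: ifPn => [th|]; last rewrite -ltNge => th.
      by apply: cY; exists (2 * t) => //=; rewrite in_itv/=; lra.
    by apply: cY'; exists (2 * t - 1) => //=; rewrite in_itv/=; lra.
  + by rewrite /C mulr0 ifT// invr_ge0.
  + rewrite /C ifF; last by lra.
    by rewrite mulr1 (_ : 2 - 1 = 1)//; lra.
- move=> s t s0 st t1.
  have [th|th] := leP t 2^-1; first exact: left.
  have [sh|sh] := leP s 2^-1; last by apply: right => //; lra.
  have h2 : (2^-1 : R) <= 1 by lra.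
  have := euclidean_dist_triangle (C 2^-1) (C s) (C t).
  have := left s 2^-1 s0 sh (lexx _); have := right 2^-1 t (lexx _) (ltW th) t1.
  lra.
- rewrite /l2 mulr0 mulr1 ifF; last by lra.
  rewrite ifT; last by lra.
  by rewrite (_ : 2 - 1 = 1); lra.
Qed.

Lemma joined_lipschitz c (T K : R) : 0 <= T -> 0 <= K ->
  (forall s, 0 <= s <= T -> Y (c s)) ->
  (forall s t, 0 <= s -> s <= t -> t <= T -> ed (c s) (c t) <= K * (t - s)) ->
  joined (c 0) (c T) (K * T).
Proof.
move=> T0 K0 cY cK; exists (fun t => c (T * t)), (fun t => K * (T * t)).
have cl s t : 0 <= s -> s <= t -> t <= 1 ->
    ed (c (T * s)) (c (T * t)) <= K * (T * t) - K * (T * s).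
  by move=> s0 st t1; rewrite -mulrBr; apply: cK; [nra| nra| nra].
split=> //; last by lra.
split; rewrite ?mulr0 ?mulr1//; last first.
  move=> y [t /=]; rewrite in_itv/= => t01 <-; apply: cY; nra.
apply/within01_continuousP => s s01 e e0.
have KT : 0 < K * T + 1 by rewrite ltr_wpDl// mulr_ge0.
exists (e / (K * T + 1)); first exact: divr_gt0.
move=> t t01; rewrite ltr_pdivlMr// => st.
have : ed (c (T * s)) (c (T * t)) <= K * T * `|s - t|.
  have [sLt|tLs] := leP s t.
    have -> : `|s - t| = t - s by rewrite distrC ger0_norm// subr_ge0.
    by case/andP: s01 t01 => s0 _ /andP[_ t1]; have := cl s t s0 sLt t1; lra.
  rewrite euclidean_dist_sym.
  have -> : `|s - t| = s - t by rewrite ger0_norm// subr_ge0 ltW.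
  by case/andP: s01 t01 => _ s1 /andP[t0 _]; have := cl t s t0 (ltW tLs) s1; lra.
by have := mulr_ge0 K0 T0; have := normr_ge0 (s - t); nra.
Qed.

Lemma polygonal_length_nil a b c : polygonal_length a b c [::] = 0.
Proof. by rewrite /polygonal_length big_nil. Qed.

Lemma polygonal_length_cons a b b' c x (s : seq R) :
  polygonal_length a b c (x :: s) = ed (c a) (c x) + polygonal_length x b' c s.
Proof.
rewrite /polygonal_length /= big_nat_recl//=; congr (_ + _).
rewrite big_nat [in RHS]big_nat; apply: eq_bigr => i /andP[_ is_].
by congr (ed (c _) (c _)); apply: set_nth_default => //=; exact: leqW.
Qed.

Lemma polygonal_length_rcons a b b' c x (s : seq R) :
  polygonal_length a b c (rcons s x) = polygonal_length a b' c s + ed (c (last a s)) (c x).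
Proof.
elim: s a => [a|y s ih a] /=.
  by rewrite (polygonal_length_cons _ _ b') !polygonal_length_nil addr0 add0r.
rewrite (polygonal_length_cons a b b) (polygonal_length_cons a b' b').
by rewrite ih addrA.
Qed.

Lemma joined_interior_dist p q L : joined p q L -> (interior_dist Y p q <= L%:E)%E.
Proof.
move=> [c [l [cpq cl lL]]].
have : (curve_length 0 1 c <= L%:E)%E.
  apply: ge_ereal_sup => _ [s [ps /eqP ls] <-]; rewrite lee_fin.
  suff poly (u : seq R) a : path <%O a u -> last a u = 1 -> 0 <= a ->
      polygonal_length a 1 c u <= l 1 - l a.
    by apply: le_trans lL; exact: poly.
  elim: u a => [a _ /= -> _|x u ih a /=].
    by rewrite polygonal_length_nil subrr.
  move=> /andP[ax xu] lu a0; rewrite (polygonal_length_cons _ _ 1).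
  have x1 : x <= 1.
    by apply: (@itv_partition_le _ _ x 1 u); split=> //; apply/eqP.
  have x0 : 0 <= x by lra.
  by have := ih x xu lu x0; have := cl a x a0 (ltW ax) x1; lra.
by apply: le_trans; apply: ereal_inf_lbound; exists c.
Qed.

(** The strict inequality provides a curve of length below [L]; its arclength, the supremum of the
    polygonal lengths over partitions of [0, t], serves as [l]. *)
Lemma interior_dist_joined p q L : (interior_dist Y p q < L%:E)%E -> joined p q L.
Proof.
move=> /ereal_inf_lt[_ [c cpq <-] cL].
have pl (u : seq R) : itv_partition 0 1 u -> polygonal_length 0 1 c u <= L.
  move=> hu; rewrite -lee_fin; apply/ltW/(le_lt_trans _ cL).
  by apply: ereal_sup_ubound; exists u.
pose V t := [set polygonal_length 0 1 c u | u in itv_partition 0 t].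
have VL t : 0 <= t -> t <= 1 -> ubound (V t) L.
  move=> t0 t1 _ [s hs <-]; move: t1; rewrite [t <= 1]le_eqVlt => /predU1P[t1|t1].
    by apply: pl; rewrite -t1.
  (* Adding the point 1 to a partition of [0, t] does not shorten the polygon. *)
  have hs1 : itv_partition 0 1 (rcons s 1).
    by rewrite -cats1; apply: itv_partition_cat hs _; exact: itv_partition1.
  have := pl _ hs1; rewrite (polygonal_length_rcons _ _ 1).
  have := euclidean_dist_ge0 (c (last 0 s)) (c 1); lra.
have V0 t : 0 <= t -> V t !=set0.
  rewrite le_eqVlt => /predU1P[<-|t0]; first by exists (polygonal_length 0 1 c [::]), [::].
  by exists (polygonal_length 0 1 c [:: t]), [:: t] => //; exact: itv_partition1.
exists c, (fun t => sup (V t)); split=> //.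
- move=> s t s0; rewrite le_eqVlt => /predU1P[->|st] t1.
    by rewrite euclidean_distxx subrr.
  rewrite lerBrDr -lerBrDl; apply: ge_sup; first exact: V0.
  move=> _ [u us <-]; have [_ /eqP lu] := us.
  rewrite lerBrDl -lu addrC -(polygonal_length_rcons _ 1).
  apply: ub_le_sup; first by exists L; apply: VL; lra.
  exists (rcons u t) => //.
  by rewrite -cats1; apply: itv_partition_cat us _; exact: itv_partition1.
- have : sup (V 1) <= L by apply: ge_sup; [exact: V0|apply: VL].
  have : 0 <= sup (V 0).
    apply: ub_le_sup; first by exists L; apply: VL.
    by exists [::] => //; rewrite polygonal_length_nil.
  lra.
Qed.

End rectifiable_curves.

(** * Vertical geodesics *)

Section vertical_paths.
Context {R : realType} (X : metricType R) (B : X -> R).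

Definition vertical (x : X) (T : R) (v : R -> X) : Prop :=
  [/\ v 0 = x,
      forall s t, 0 <= s <= T -> 0 <= t <= T -> mdist (v s) (v t) = `|s - t| &
      forall t, 0 <= t <= T -> B (v t) = B x - t].

Record horospace (D : R) : Prop := Horospace {
  horospace_ge0 : 0 <= D;
  horospace_proper : proper_space X;
  horospace_geodesic : geodesic_space X;
  horospace_horo : horofunction B D;
  horospace_ascending : ascending B }.

(** Along a geodesic from [x] to a point whose height differs by the full length, the Lipschitz
    bounds from both ends determine [B]. *)
Lemma vertical_exists (D : R) (x : X) (T : R) : horospace D -> 0 <= T ->
  exists v, vertical x T v.
Proof.
move=> hB T0; have [x' xx' Bx'] := horospace_ascending hB x T0.
have [g gg] := geodesic_exists x x' (horospace_geodesic hB).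
exists g; split; first by case: gg.
  by move=> s t; rewrite -xx'; exact: geodesic_pathP.
move=> t; rewrite -xx' => tT; have hL := horo_lip (horospace_horo hB).
have := hL x (g t); rewrite (geodesic_path0 gg)//.
have := hL (g t) x'; rewrite (geodesic_path1 gg)//; lra.
Qed.

Lemma vertical_product x T v t : vertical x T v -> 0 <= t <= T ->
  busemann_product B x (v t) = B (v t).
Proof.
move=> [v0 vi vB] tT; have /andP[t0 _] := tT.
have : mdist x (v t) = t.
  rewrite -{1}v0 vi//; last by rewrite lexx; lra.
  by rewrite sub0r normrN ger0_norm.
by rewrite /busemann_product vB//; lra.
Qed.

(* [busemann_product B x y] is the height at which the vertical geodesics from
   [x] and from [y] merge. *)
Lemma vertical_close D x y S T v w s t : horospace D ->
  vertical x S v -> vertical y T w -> 0 <= s <= S -> 0 <= t <= T ->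
  B (v s) = B (w t) -> B (v s) <= busemann_product B x y ->
  mdist (v s) (w t) <= 4 * D.
Proof.
move=> hB hv hw sS tT vw vxy; have D0 := horospace_ge0 hB.
have vx := vertical_product hv sS; have wy := vertical_product hw tT.
have := horo_ultra (horospace_horo hB) (v s) x y.
have := horo_ultra (horospace_horo hB) (v s) y (w t).
rewrite (busemann_productC B (v s) x) vx wy.
rewrite [busemann_product B (v s) (w t)]/busemann_product -vw; lra.
Qed.

Lemma vertical_limit D (I : Type) (U : set_system I) (UU : UltraFilter U)
    (q : I -> X) (x : X) (T : R) (v : I -> R -> X) :
  horospace D -> 0 <= T -> (forall i, vertical (q i) T (v i)) ->
  (forall e, 0 < e -> \forall i \near U, mdist x (q i) < e) ->
  exists2 w, vertical x T w &
    forall t, 0 <= t <= T -> forall e, 0 < e ->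
      \forall i \near U, mdist (w t) (v i t) < e.
Proof.
move=> hB T0 hv hq; have hL := horo_lip_norm _ _ (horospace_horo hB).
have /choice[w wP] (t : R) : exists y, 0 <= t <= T ->
    forall e, 0 < e -> \forall i \near U, mdist y (v i t) < e.
  have [tT|_] := boolP (0 <= t <= T); last by exists x.
  have [|y yP] := @ultra_limit _ _ (horospace_proper hB) _ U UU (v ^~ t) x (1 + T).
    near=> i; have [v0 vi _] := hv i.
    have : mdist x (q i) < 1 by near: i; exact: hq.
    have := metric_triangle x (q i) (v i t).
    have -> : mdist (q i) (v i t) = t; last by lra.
    rewrite -v0 vi//; last by rewrite lexx.
    by rewrite sub0r normrN ger0_norm//; lra.
  by exists y.
have wi s t : 0 <= s <= T -> 0 <= t <= T -> mdist (w s) (w t) = `|s - t|.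
  move=> sT tT; apply/eqP; rewrite eq_le; apply/andP; split.
    apply/ler_addgt0Pr => e e0; have e2 : 0 < e / 2 by lra.
    near U => i; have [_ vi _] := hv i; rewrite -(vi s t)//.
    have : mdist (w s) (v i s) < e / 2 by near: i; exact: wP.
    have : mdist (w t) (v i t) < e / 2 by near: i; exact: wP.
    have := metric_triangle (w s) (v i s) (w t).
    have := metric_triangle (v i s) (v i t) (w t).
    by rewrite (metric_sym (v i t)); lra.
  apply/ler_addgt0Pr => e e0; have e2 : 0 < e / 2 by lra.
  near U => i; have [_ vi _] := hv i; rewrite -(vi s t)//.
  have : mdist (w s) (v i s) < e / 2 by near: i; exact: wP.
  have : mdist (w t) (v i t) < e / 2 by near: i; exact: wP.
  have := metric_triangle (v i s) (w s) (v i t).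
  have := metric_triangle (w s) (w t) (v i t).
  by rewrite (metric_sym (v i s) (w s)); lra.
have TT : 0 <= (0 : R) <= T by lra.
exists w => //; split => //.
  apply: mdist_positivity; apply/eqP; rewrite eq_le mdist_ge0 andbT.
  apply/ler_addgt0Pr => e e0; have e2 : 0 < e / 2 by lra.
  near U => i; have [v0 _ _] := hv i.
  have : mdist (w 0) (v i 0) < e / 2 by near: i; exact: wP.
  have : mdist x (q i) < e / 2 by near: i; exact: hq.
  have := metric_triangle (w 0) (v i 0) x; rewrite v0.
  by rewrite (metric_sym (q i)); lra.
move=> t tT; apply/eqP; rewrite -subr_eq0 -normr_eq0 eq_le normr_ge0 andbT.
apply/ler_addgt0Pr => e e0; have e2 : 0 < e / 2 by lra.
near U => i; have [_ _ vB] := hv i.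
have : mdist (w t) (v i t) < e / 2 by near: i; exact: wP.
have : mdist x (q i) < e / 2 by near: i; exact: hq.
have := hL x (q i); have := hL (w t) (v i t); rewrite vB//.
by rewrite !ler_norml; lra.
Unshelve. all: by end_near. Qed.

End vertical_paths.

Section horospherical_paths.
Context {R : realType} {X1 X2 : metricType R} {B1 : X1 -> R} {B2 : X2 -> R} {D : R}.
Hypothesis H1 : horospace B1 D.
Local Notation Y := (horospherical_product B1 B2).

Let sqrt2_ge0 : 0 <= Num.sqrt 2 :> R.
Proof. exact: sqrtr_ge0. Qed.

Let sqr_sqrt2 : Num.sqrt 2 ^+ 2 = 2 :> R.
Proof. exact: sqr_sqrtr. Qed.

Lemma joined_vertical (p : X1 * X2) (T s : R) v1 v2 : Y p ->
  vertical B1 p.1 T v1 -> vertical B2 p.2 T v2 -> 0 <= s <= T ->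
  joined Y p (v1 s, v2 s) (Num.sqrt 2 * s).
Proof.
move=> Yp [v10 v1i v1B] [v20 v2i v2B] sT.
have -> : p = (v1 0, v2 0) by rewrite v10 v20; case: p {v10 v20 Yp v1B v2B}.
apply: (@joined_lipschitz _ _ _ _ (fun t => (v1 t, v2 t))) => //.
- by case/andP: sT.
- by move=> t ts; rewrite /horospherical_product/= v1B ?v2B ?Yp//; lra.
- move=> t u t0 tu us; rewrite euclidean_dist_le/=; last by rewrite mulr_ge0// subr_ge0.
  rewrite v1i; [|lra..]; rewrite v2i; [|lra..].
  by rewrite exprMn sqr_sqrt2 distrC ger0_norm ?subr_ge0//; lra.
Qed.

(** The first coordinate runs along a geodesic from [a] to [b] while the second slides on the
    vertical path [v] so as to keep the same height. Each coordinate has speed at most 1, whence the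
    factor 2; the hypothesis keeps the parameter of [v] in [0, T]. *)
Lemma joined_follow (a b : X1) (y : X2) (T : R) v : vertical B2 y T v ->
  mdist a b <= B2 y - B1 a <= T - mdist a b ->
  joined Y (a, v (B2 y - B1 a)) (b, v (B2 y - B1 b)) (2 * mdist a b).
Proof.
move=> [v0 vi vB] aT; have [g gg] := geodesic_exists a b (horospace_geodesic H1).
have hL := horo_lip_norm _ _ (horospace_horo H1).
have gT t : 0 <= t <= mdist a b -> 0 <= B2 y - B1 (g t) <= T.
  move=> tL; have := hL a (g t); rewrite (geodesic_path0 gg)// ler_norml.
  by move: aT tL; lra.
have [g0 g1 _] := gg.
have := @joined_lipschitz _ _ _ Y (fun t => (g t, v (B2 y - B1 (g t)))) (mdist a b) 2.
rewrite g0 g1; apply => //; first exact: mdist_ge0.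
- by move=> t tL; rewrite /horospherical_product/= vB ?gT//; lra.
- move=> s t s0 st tL; have sL : 0 <= s <= mdist a b by lra.
  have tL' : 0 <= t <= mdist a b by lra.
  apply: le_trans (euclidean_dist_le_add _ _) _ => /=.
  rewrite vi ?gT//; have := hL (g t) (g s).
  rewrite !(geodesic_pathP gg)// (distrC s t) (ger0_norm (x := t - s)) ?subr_ge0//.
  by rewrite (_ : B2 y - _ - _ = B1 (g t) - B1 (g s)); lra.
Qed.

Lemma joined_swap (p q : X1 * X2) L : joined Y p q L ->
  joined (horospherical_product B2 B1) (p.2, p.1) (q.2, q.1) L.
Proof.
move=> [c [l [[cc cY c0 c1] cl lL]]].
exists (fun t => ((c t).2, (c t).1)), l; split=> //.
- split; rewrite ?c0 ?c1//.
  + apply/within01_continuousP => s s01 e e0.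
    have [d d0 hd] := (within01_continuousP c).1 cc s s01 e e0.
    by exists d => // t t01 st; have := hd t t01 st; rewrite /euclidean_dist addrC.
  + move=> y [t t01 <-]; have : Y (c t) by apply: cY; exists t.
    by rewrite /horospherical_product/= => ->.
- by move=> s t s0 st t1; have := cl s t s0 st t1; rewrite /euclidean_dist addrC.
Qed.

End horospherical_paths.

(** * The metric of the horospherical product *)

Section horospherical_metric.
Context {R : realType} {X1 X2 : metricType R} {B1 : X1 -> R} {B2 : X2 -> R} {D : R}.
Local Notation Y := (horospherical_product B1 B2).

(** Four legs: up from [p]; across in the first factor, the second coordinate sliding on [v2];
    across in the second factor, the first coordinate sliding on [w1]; down to [q]. *)
Lemma joined_up (H1 : horospace B1 D) (H2 : horospace B2 D)
    (p q : X1 * X2) (S T s t : R) v1 v2 w1 w2 : Y p -> Y q ->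
  vertical B1 p.1 S v1 -> vertical B2 p.2 S v2 ->
  vertical B1 q.1 T w1 -> vertical B2 q.2 T w2 ->
  B1 p.1 - s = B1 q.1 - t ->
  mdist (v1 s) (w1 t) <= s <= S - mdist (v1 s) (w1 t) ->
  mdist (v2 s) (w2 t) <= t <= T - mdist (v2 s) (w2 t) ->
  joined Y p q (Num.sqrt 2 * (s + t) + 2 * (mdist (v1 s) (w1 t) + mdist (v2 s) (w2 t))).
Proof.
move=> Yp Yq hv1 hv2 hw1 hw2 st e1 e2.
have e1_0 := mdist_ge0 (v1 s) (w1 t); have e2_0 := mdist_ge0 (v2 s) (w2 t).
have sS : 0 <= s <= S by move: e1 e1_0; lra.
have tT : 0 <= t <= T by move: e2 e2_0; lra.
have [_ _ v1B] := hv1; have [_ _ v2B] := hv2.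
have [_ _ w1B] := hw1; have [_ _ w2B] := hw2.
have := Yp; have := Yq; rewrite /horospherical_product/= => Bq Bp.
have J1 := joined_vertical Yp hv1 hv2 sS.
have J4 := joined_sym (joined_vertical Yq hw1 hw2 tT).
have J2 := joined_follow H1 (a := v1 s) (b := w1 t) hv2.
have J3 := joined_follow H2 (a := v2 s) (b := w2 t) hw1.
move: J2; rewrite v1B// w1B// -Bp -st (_ : B1 p.1 - (B1 p.1 - s) = s); last by lra.
move=> /(_ e1) J2.
move: J3; rewrite v2B// w2B// -Bp -Bq st (_ : B1 q.1 - (B1 q.1 - t) = t); last by lra.
move=> /(_ e2)/joined_swap J3.
have J := joined_trans J1 (joined_trans J2 (joined_trans J3 J4)).
apply: (joined_le J); lra.
Qed.

Lemma joined_coarse (H1 : horospace B1 D) (H2 : horospace B2 D) (p q : X1 * X2) m :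
  Y p -> Y q -> m <= busemann_product B1 p.1 q.1 -> m <= busemann_product B2 p.2 q.2 ->
  joined Y p q (Num.sqrt 2 * (B1 p.1 + B1 q.1 - 2 * m + 8 * D) + 16 * D).
Proof.
move=> Yp Yq m1 m2; have D0 := horospace_ge0 H1.
have := Yp; have := Yq; rewrite /horospherical_product/= => Bq Bp.
(* Crossing costs at most 4 D in each factor and makes the other coordinate slide by at most as much
   in either direction. The summand 4 D leaves this room below, and the length s + 4 D of the
   vertical paths leaves it above. *)
pose s := B1 p.1 - m + 4 * D; pose t := B1 q.1 - m + 4 * D.
have mp := busemann_product_le p.1 q.1 (horospace_horo H1).
have mq := busemann_product_le q.1 p.1 (horospace_horo H1).
rewrite busemann_productC in mq.
have s0 : 4 * D <= s by rewrite /s; lra.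
have t0 : 4 * D <= t by rewrite /t; lra.
have sS : 0 <= s <= s + 4 * D by lra.
have tT : 0 <= t <= t + 4 * D by lra.
have S0 : 0 <= s + 4 * D by lra.
have T0 : 0 <= t + 4 * D by lra.
have [v1 hv1] := vertical_exists p.1 H1 S0; have [v2 hv2] := vertical_exists p.2 H2 S0.
have [w1 hw1] := vertical_exists q.1 H1 T0; have [w2 hw2] := vertical_exists q.2 H2 T0.
have [_ _ v1B] := hv1; have [_ _ v2B] := hv2.
have [_ _ w1B] := hw1; have [_ _ w2B] := hw2.
have e1 : mdist (v1 s) (w1 t) <= 4 * D.
  apply: vertical_close H1 hv1 hw1 sS tT _ _; rewrite v1B ?w1B// /s /t; lra.
have e2 : mdist (v2 s) (w2 t) <= 4 * D.
  by apply: vertical_close H2 hv2 hw2 sS tT _ _; rewrite v2B ?w2B// -?Bp -?Bq /s /t; lra.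
have st : B1 p.1 - s = B1 q.1 - t by rewrite /s /t; lra.
have e1s : mdist (v1 s) (w1 t) <= s <= s + 4 * D - mdist (v1 s) (w1 t) by lra.
have e2t : mdist (v2 s) (w2 t) <= t <= t + 4 * D - mdist (v2 s) (w2 t) by lra.
have J := joined_up H1 H2 Yp Yq hv1 hv2 hw1 hw2 st e1s e2t.
apply: (joined_le J).
have -> : B1 p.1 + B1 q.1 - 2 * m + 8 * D = s + t by rewrite /s /t; lra.
lra.
Qed.

(* The hypotheses are arguments since the metric below depends on them. *)
Definition horo_prod (H1 : horospace B1 D) (H2 : horospace B2 D) : Type :=
  set_type Y.

HB.instance Definition _ H1 H2 := Choice.on (horo_prod H1 H2).

Section metric.
Variables (H1 : horospace B1 D) (H2 : horospace B2 D).
Local Notation M := (horo_prod H1 H2).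
Implicit Types (p q r : M).

Definition hval p : X1 * X2 := \val p.

Lemma hvalP p : Y (hval p).
Proof. by have := set_valP p. Qed.

(** A real infimum, so that the metric axioms follow from reversal and concatenation in [joined];
    agreement with the extended real [interior_dist] is proved afterwards. *)
Definition hdist p q : R := inf [set L | joined Y (hval p) (hval q) L].

Lemma hdist_has_inf p q : has_inf [set L | joined Y (hval p) (hval q) L].
Proof.
split; last by exists 0 => L /joined_euclidean; apply: le_trans; exact: euclidean_dist_ge0.
pose m := Num.min (busemann_product B1 (hval p).1 (hval q).1)
  (busemann_product B2 (hval p).2 (hval q).2).
have := joined_coarse H1 H2 (hvalP p) (hvalP q) (m := m).
by rewrite !ge_min !lexx orbT => /(_ isT isT); eexists; eassumption.
Qed.

Lemma hdist_le p q L : joined Y (hval p) (hval q) L -> hdist p q <= L.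
Proof. by move=> J; apply: ge_inf => //; case: (hdist_has_inf p q). Qed.

Lemma hdist_lt p q L : hdist p q < L -> joined Y (hval p) (hval q) L.
Proof.
move=> pqL; have e0 : 0 < L - hdist p q by lra.
have [l J lL] := inf_adherent e0 (hdist_has_inf p q).
by apply: (joined_le J); rewrite -/(hdist p q) in lL; lra.
Qed.

Lemma hdist_euclidean p q : euclidean_dist (hval p) (hval q) <= hdist p q.
Proof.
by apply: lb_le_inf; [case: (hdist_has_inf p q)|move=> L /joined_euclidean].
Qed.

Let hdistxx p : hdist p p = 0.
Proof.
apply/eqP; rewrite eq_le hdist_le; last exact/joinedxx/hvalP.
by apply: le_trans (hdist_euclidean p p); exact: euclidean_dist_ge0.
Qed.

Let hdist_pos p q : hdist p q = 0 -> p = q.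
Proof.
move=> pq0; have := hdist_euclidean p q; rewrite pq0 => pq.
apply: val_inj => /=; rewrite -/(hval p) -/(hval q).
have := euclidean_dist_ge1 (hval p) (hval q); have := euclidean_dist_ge2 (hval p) (hval q).
move: (hval p) (hval q) pq => [a b] [a' b'] /= pq e2 e1.
by congr (_, _); apply: mdist_positivity; apply/eqP; rewrite eq_le mdist_ge0 andbT; lra.
Qed.

Let hdist_sym p q : hdist p q = hdist q p.
Proof.
by congr inf; apply/seteqP; split => L /joined_sym.
Qed.

Let hdist_triangle q p r : hdist p r <= hdist p q + hdist q r.
Proof.
apply/ler_addgt0Pr => e e0.
have J1 : joined Y (hval p) (hval q) (hdist p q + e / 2) by apply: hdist_lt; lra.
have J2 : joined Y (hval q) (hval r) (hdist q r + e / 2) by apply: hdist_lt; lra.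
by have := hdist_le (joined_trans J1 J2); lra.
Qed.

HB.instance Definition _ := isMetric.Build R M hdistxx hdist_pos hdist_sym hdist_triangle.

Lemma interior_metric_horo_prod : interior_metric_space Y hval.
Proof.
split.
  split=> //.
  - by move=> p _; exact: hvalP.
  - by move=> p Yp; exists (exist _ p (mem_set Yp)).
move=> p q; change ((hdist p q)%:E = interior_dist Y (hval p) (hval q)).
apply/eqP; rewrite eq_le; apply/andP; split.
- rewrite leNgt; apply/negP => lt.
  have [L [L1 L2]] : exists L, (interior_dist Y (hval p) (hval q) < L%:E)%E /\ L < hdist p q.
    case: (interior_dist _ _ _) lt => [x| |] //=.
      by rewrite lte_fin => xh; exists ((x + hdist p q) / 2); rewrite lte_fin; lra.
    by move=> _; exists (hdist p q - 1); rewrite ltNyr; lra.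
  by have := hdist_le (interior_dist_joined L1); lra.
- apply/lee_addgt0Pr => e e0; rewrite -EFinD.
  by apply: joined_interior_dist; apply: hdist_lt; lra.
Qed.

End metric.
End horospherical_metric.

(** * Properness and existence of geodesics *)

Section curve_restriction.
Context {R : realType} {X1 X2 : metricType R} (Y : set (X1 * X2)).

Lemma joined_restrict p q (c : R -> X1 * X2) (l : R -> R) (a b : R) :
  curve_in Y p q c ->
  (forall s t, 0 <= s -> s <= t -> t <= 1 -> euclidean_dist (c s) (c t) <= l t - l s) ->
  0 <= a -> a <= b -> b <= 1 -> joined Y (c a) (c b) (l b - l a).
Proof.
move=> [cc cY _ _] cl a0 ab b1; pose r t := a + t * (b - a).
have r01 t : 0 <= t <= 1 -> 0 <= r t <= 1.
  move=> t01; have : 0 <= t * (b - a) <= b - a.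
    by rewrite mulr_ge0 ?subr_ge0//= ?ler_piMl ?subr_ge0//; lra.
  by rewrite /r; lra.
exists (c \o r), (l \o r); split.
- split; rewrite /r/= ?mul0r ?addr0 ?mul1r//; last by congr c; lra.
  + apply/within01_continuousP => s s01 e e0.
    have [d d0 hd] := (within01_continuousP c).1 cc _ (r01 s s01) e e0.
    exists d => // t t01 st; apply: hd; first exact: r01.
    rewrite /r opprD addrACA subrr add0r -mulrBl normrM (ger0_norm (x := b - a)) ?subr_ge0//.
    by apply: le_lt_trans st; rewrite ler_piMr//; lra.
  + move=> y [t /=]; rewrite in_itv/= => t01 <-; apply: cY.
    by exists (r t) => //=; rewrite in_itv/=; exact: r01.
- move=> s t s0 st t1 /=; have /andP[rs _] : 0 <= r s <= 1 by apply: r01; lra.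
  have /andP[_ rt] : 0 <= r t <= 1 by apply: r01; lra.
  by apply: cl => //; rewrite /r lerD2l ler_wpM2r// subr_ge0.
- have -> : (l \o r) 1 = l b by rewrite /r /=; congr l; lra.
  by have -> : (l \o r) 0 = l a by rewrite /r /=; congr l; lra.
Qed.

End curve_restriction.

Section horospherical_geodesic.
Context {R : realType} {X1 X2 : metricType R} {B1 : X1 -> R} {B2 : X2 -> R} {D : R}.
Variables (H1 : horospace B1 D) (H2 : horospace B2 D).
Local Notation Y := (horospherical_product B1 B2).
Local Notation M := (horo_prod H1 H2).
Implicit Types (p q r : M).
Local Notation sqrt2 := (Num.sqrt (2 : R)).

Lemma sqrt2_bounds : 1 <= sqrt2 <= 2.
Proof.
have s0 : 0 <= sqrt2 by exact: sqrtr_ge0.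
have : sqrt2 ^+ 2 = 2 by exact: sqr_sqrtr.
by nra.
Qed.

Lemma horo_euclidean p q : euclidean_dist (hval p) (hval q) <= mdist p q.
Proof. exact: hdist_euclidean. Qed.

Lemma horo_dist1 p q : mdist (hval p).1 (hval q).1 <= mdist p q.
Proof. exact: le_trans (euclidean_dist_ge1 _ _) (horo_euclidean _ _). Qed.

Lemma horo_dist2 p q : mdist (hval p).2 (hval q).2 <= mdist p q.
Proof. exact: le_trans (euclidean_dist_ge2 _ _) (horo_euclidean _ _). Qed.

Lemma horo_le p q L : joined Y (hval p) (hval q) L -> mdist p q <= L.
Proof. exact: hdist_le. Qed.

Lemma horo_lt p q L : mdist p q < L -> joined Y (hval p) (hval q) L.
Proof. exact: hdist_lt. Qed.

(** Vertical paths from the [q i] converge along [U] to vertical paths from [x]. Going up by about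
    [h], crossing at distance at most h / 2 in each factor and going down costs less than 16 h =
    e. *)
Lemma horo_cvg (I : Type) (U : set_system I) (UU : UltraFilter U) (q : I -> M) (x : M) :
  (forall e, 0 < e -> \forall i \near U, mdist (hval x).1 (hval (q i)).1 < e) ->
  (forall e, 0 < e -> \forall i \near U, mdist (hval x).2 (hval (q i)).2 < e) ->
  forall e, 0 < e -> \forall i \near U, mdist x (q i) < e.
Proof.
move=> q1 q2 e e0; pose h := e / 16; have h0 : 0 < h by rewrite /h; lra.
have T0 : 0 <= 2 * h by lra.
have hT : 0 <= h <= 2 * h by lra.
have h4 : 0 < h / 4 by lra.
have /choice[v1 hv1] i := vertical_exists (hval (q i)).1 H1 T0.
have /choice[v2 hv2] i := vertical_exists (hval (q i)).2 H2 T0.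
have [w1 hw1 vw1] := vertical_limit UU H1 T0 hv1 q1.
have [w2 hw2 vw2] := vertical_limit UU H2 T0 hv2 q2.
near=> i.
(* The shift equalises the heights reached from [x] and from [q i]. *)
pose t := h + (B1 (hval (q i)).1 - B1 (hval x).1).
have qi1 : mdist (hval x).1 (hval (q i)).1 < h / 4 by near: i; exact: q1.
have wi1 : mdist (w1 h) (v1 i h) < h / 4 by near: i; exact: vw1.
have wi2 : mdist (w2 h) (v2 i h) < h / 4 by near: i; exact: vw2.
have := horo_lip_norm (hval x).1 (hval (q i)).1 (horospace_horo H1).
rewrite ler_norml => Bq.
have th : - (h / 4) <= t - h <= h / 4 by rewrite /t; lra.
have tT : 0 <= t <= 2 * h by lra.
have tn : `|h - t| <= h / 4 by rewrite ler_norml; lra.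
have [_ vi1 _] := hv1 i; have [_ vi2 _] := hv2 i.
have e1 : mdist (w1 h) (v1 i t) <= h / 2.
  by have := metric_triangle (w1 h) (v1 i h) (v1 i t); rewrite vi1//; lra.
have e2 : mdist (w2 h) (v2 i t) <= h / 2.
  by have := metric_triangle (w2 h) (v2 i h) (v2 i t); rewrite vi2//; lra.
have st : B1 (hval x).1 - h = B1 (hval (q i)).1 - t by rewrite /t; lra.
have c1 : mdist (w1 h) (v1 i t) <= h <= 2 * h - mdist (w1 h) (v1 i t) by lra.
have c2 : mdist (w2 h) (v2 i t) <= t <= 2 * h - mdist (w2 h) (v2 i t) by lra.
have := horo_le (joined_up H1 H2 (hvalP x) (hvalP (q i)) hw1 hw2 (hv1 i) (hv2 i) st c1 c2).
have s2 : sqrt2 * (h + t) <= 2 * (h + t).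
  by rewrite ler_wpM2r//; [lra|case/andP: sqrt2_bounds].
have eh : e = 16 * h by rewrite /h; lra.
lra.
Unshelve. all: by end_near. Qed.

Lemma horo_proper : proper_space M.
Proof.
move=> p r; rewrite compact_ultra => F FU Fr.
have [|x1 hx1] := @ultra_limit _ _ (horospace_proper H1) _ F FU (fun q => (hval q).1) (hval p).1 r.
  by apply: filterS Fr => q /=; apply: le_trans; exact: horo_dist1.
have [|x2 hx2] := @ultra_limit _ _ (horospace_proper H2) _ F FU (fun q => (hval q).2) (hval p).2 r.
  by apply: filterS Fr => q /=; apply: le_trans; exact: horo_dist2.
have Yx : Y (x1, x2).
  apply/eqP; rewrite -subr_eq0 -normr_eq0 eq_le normr_ge0 andbT /=.
  apply/ler_addgt0Pr => e e0; have e2 : 0 < e / 2 by lra.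
  near F => q; have := hvalP q; rewrite /horospherical_product/= => Bq.
  have := horo_lip_norm x1 (hval q).1 (horospace_horo H1).
  have := horo_lip_norm x2 (hval q).2 (horospace_horo H2).
  have : mdist x1 (hval q).1 < e / 2 by near: q; exact: hx1.
  have : mdist x2 (hval q).2 < e / 2 by near: q; exact: hx2.
  by rewrite !ler_norml; lra.
pose x : M := exist _ (x1, x2) (mem_set Yx).
have Fx := @horo_cvg _ F FU id x hx1 hx2.
exists x; split => /=.
  apply/ler_addgt0Pr => e e0; near F => q.
  have : mdist p q <= r by near: q.
  have : mdist x q < e by near: q; exact: Fx.
  by have := metric_triangle p q x; rewrite (metric_sym q x); lra.
by apply/metricType_numDomainType.fcvgrPdist_lt.
Unshelve. all: by end_near. Qed.

(** A counterexample would give a sequence converging to [x] in both coordinates but not in M. *)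
Lemma horo_continuity (x : M) (e : R) : 0 < e ->
  exists2 d : R, 0 < d & forall q, euclidean_dist (hval x) (hval q) < d -> mdist x q < e.
Proof.
move=> e0; apply: contrapT => nd.
have /choice[q hq] (n : nat) : exists q : M,
    euclidean_dist (hval x) (hval q) < n.+1%:R^-1 /\ e <= mdist x q.
  apply: contrapT => nq; apply: nd; exists n.+1%:R^-1 => // q xq.
  by rewrite ltNge; apply/negP => eq; apply: nq; exists q.
have [U [UU oU]] := ultraFilterLemma (eventually_filter).
have xq (d : R) : 0 < d -> \forall n \near U, euclidean_dist (hval x) (hval (q n)) < d.
  move=> d0; apply: oU; near=> n; apply: lt_trans (hq n).1 _.
  by near: n; exact: near_infty_natSinv_lt (PosNum d0).
have /filter_ex[n] : \forall n \near U, mdist x (q n) < e.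
  apply: (horo_cvg UU) => // d /xq; apply: filterS => n.
    exact: le_lt_trans (euclidean_dist_ge1 _ _).
  exact: le_lt_trans (euclidean_dist_ge2 _ _).
by rewrite ltNge (hq n).2.
Unshelve. all: by end_near. Qed.

(** A curve of length at most d(x,y) + e is parametrised by the distance from [x], which takes all
    intermediate values. The lengths before and after a point at distance [s] are at least [s] and
    d(x,y) - s, so together they exceed these numbers by at most [e]. *)
Lemma horo_almost_geodesic (x y : M) (e : R) : 0 < e -> exists g : R -> M,
  forall s, 0 <= s <= mdist x y -> [/\ mdist x (g s) = s,
    mdist (g s) y <= mdist x y - s + e &
    forall t, 0 <= t <= mdist x y -> mdist (g s) (g t) <= `|s - t| + e].
Proof.
move=> e0; set L := mdist x y.
have [c [l [cxy cl lL]]] : joined Y (hval x) (hval y) (L + e) by apply: horo_lt; rewrite -/L; lra.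
have [cc cY c0 c1] := cxy.
have /choice[m mP] (t : R) : exists p : M, 0 <= t <= 1 -> hval p = c t.
  have [t01|_] := boolP (0 <= t <= 1); last by exists x.
  have Yt : Y (c t) by apply: cY; exists t => //=; rewrite in_itv.
  by exists (exist _ (c t) (mem_set Yt)).
have ml s t : 0 <= s -> s <= t -> t <= 1 -> mdist (m s) (m t) <= l t - l s.
  move=> s0 st t1; apply: horo_le; rewrite !mP; [|lra..].
  exact: joined_restrict cxy _ _ _ _.
have m0 : m 0 = x by apply: val_inj; have := mP 0; rewrite /hval c0 => ->//; rewrite lexx ler01.
have m1 : m 1 = y by apply: val_inj; have := mP 1; rewrite /hval c1 => ->//; rewrite lexx ler01.
have mc : {within `[0, 1], continuous (fun t => mdist x (m t))}.
  apply/subspace_continuousP => s; rewrite /= in_itv/= => s01.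
  move=> W /nbhs_ballP[d /= d0 dW].
  have [r r0 hr] := horo_continuity (m s) d0.
  have [h h0 hh] := (within01_continuousP c).1 cc s s01 r r0.
  apply/nbhs_ballP; exists h => //= t st; rewrite in_itv/= => t01; apply: dW.
  rewrite /ball/=; apply: le_lt_trans (hr (m t) _); last by rewrite !mP//; exact: hh.
  have := metric_triangle x (m s) (m t); have := metric_triangle x (m t) (m s).
  by rewrite (metric_sym (m t)) ler_norml; lra.
have /choice[T TP] (s : R) : exists t, 0 <= s <= L -> 0 <= t <= 1 /\ mdist x (m t) = s.
  have [sL|_] := boolP (0 <= s <= L); last by exists 0.
  have [||t] := @IVT R (fun t => mdist x (m t)) 0 1 s _ mc; first exact: ler01.
    by rewrite m0 m1 mdistxx min_l ?max_r// mdist_ge0.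
  by rewrite in_itv; exists t.
exists (m \o T) => s sL /=; have [Ts xs] := TP s sL.
have xs' : s <= l (T s) - l 0 by rewrite -{1}xs -{1}m0; apply: ml; lra.
split=> //.
  by have := ml (T s) 1; rewrite m1; move=> /(_ _ _ _)/le_trans; apply; lra.
move=> t tL; have [Tt xt] := TP t tL.
have xt' : t <= l (T t) - l 0 by rewrite -{1}xt -{1}m0; apply: ml; lra.
have ys : L - s <= l 1 - l (T s).
  have : mdist (m (T s)) y <= l 1 - l (T s) by rewrite -m1; apply: ml; lra.
  by have := metric_triangle x (m (T s)) y; rewrite xs -/L; lra.
have yt : L - t <= l 1 - l (T t).
  have : mdist (m (T t)) y <= l 1 - l (T t) by rewrite -m1; apply: ml; lra.
  by have := metric_triangle x (m (T t)) y; rewrite xt -/L; lra.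
have sn := ler_norm (s - t); have tn := ler_norm (t - s); rewrite distrC in tn.
(* [T] need not be monotone, so this order is unrelated to that of [s] and [t]. *)
have [st|st] := leP (T s) (T t).
  have : mdist (m (T s)) (m (T t)) <= l (T t) - l (T s) by apply: ml; lra.
  by lra.
have : mdist (m (T t)) (m (T s)) <= l (T s) - l (T t) by apply: ml; lra.
by rewrite metric_sym; lra.
Qed.

Lemma horo_geodesic : geodesic_space M.
Proof.
move=> x y; set L := mdist x y; have L0 : 0 <= L by exact: mdist_ge0.
have [k k0 kU] : exists2 k : nat -> R, (forall n, 0 < k n) &
    forall e, 0 < e -> \forall n \near \oo, k n < e.
  by exists (fun n => n.+1%:R^-1) => // e e0; exact: near_infty_natSinv_lt (PosNum e0).
have /choice[g gP] (n : nat) := horo_almost_geodesic x y (k0 n).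
have [U [UU oU]] := ultraFilterLemma (eventually_filter).
have Ue (e : R) : 0 < e -> \forall n \near U, k n < e.
  by move=> e0; apply: oU; exact: kU.
have /choice[w wP] (s : R) : exists p : M, 0 <= s <= L ->
    forall e, 0 < e -> \forall n \near U, mdist p (g n s) < e.
  have [sL|_] := boolP (0 <= s <= L); last by exists x.
  have [|p pP] := @ultra_limit _ _ horo_proper _ U UU (g ^~ s) x L; last by exists p.
  by near=> n; have [-> _ _] := gP n s sL; case/andP: sL.
have w0 : w 0 = x.
  apply: mdist_positivity; apply/eqP; rewrite eq_le mdist_ge0 andbT.
  apply/ler_addgt0Pr => e e0; near U => n.
  have : mdist (w 0) (g n 0) < e by near: n; apply: wP => //; rewrite lexx.
  have [|+ _ _] := gP n 0; first by rewrite lexx.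
  by have := metric_triangle (w 0) (g n 0) x; rewrite (metric_sym (g n 0)); lra.
have wL : w L = y.
  apply: mdist_positivity; apply/eqP; rewrite eq_le mdist_ge0 andbT.
  apply/ler_addgt0Pr => e e0; have e2 : 0 < e / 2 by lra.
  near U => n.
  have : mdist (w L) (g n L) < e / 2 by near: n; apply: wP => //; rewrite lexx andbT.
  have : k n < e / 2 by near: n; exact: Ue.
  have [|_ + _] := gP n L; first by rewrite -/L lexx andbT.
  by have := metric_triangle (w L) (g n L) y; rewrite -/L; lra.
exists (w @` `[0, L]), w => //; split=> //.
move=> s t; rewrite !in_itv/= -/L => sL tL.
apply/eqP; rewrite eq_le; apply/andP; split.
  apply/ler_addgt0Pr => e e0; have e2 : 0 < e / 3 by lra.
  near U => n.
  have : mdist (w s) (g n s) < e / 3 by near: n; exact: wP.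
  have : mdist (w t) (g n t) < e / 3 by near: n; exact: wP.
  have : k n < e / 3 by near: n; exact: Ue.
  have [_ _ /(_ t tL)] := gP n s sL.
  have := metric_triangle (w s) (g n s) (w t).
  have := metric_triangle (g n s) (g n t) (w t).
  by rewrite (metric_sym (g n t)); lra.
(* For the lower bound, [g n s] and [g n t] lie at distance exactly [s] and [t] from [x]. *)
apply/ler_addgt0Pr => e e0; have e2 : 0 < e / 2 by lra.
near U => n.
have : mdist (w s) (g n s) < e / 2 by near: n; exact: wP.
have : mdist (w t) (g n t) < e / 2 by near: n; exact: wP.
have [xs _ _] := gP n s sL; have [xt _ _] := gP n t tL.
have := metric_triangle x (g n s) (g n t); have := metric_triangle x (g n t) (g n s).
have := metric_triangle (g n s) (w s) (g n t).
have := metric_triangle (w s) (w t) (g n t).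
rewrite (metric_sym (g n s) (w s)) (metric_sym (g n t) (g n s)) xs xt.
have [st|ts] := leP s t.
  have -> : `|s - t| = t - s by rewrite distrC ger0_norm// subr_ge0.
  by lra.
have -> : `|s - t| = s - t by rewrite ger0_norm// subr_ge0 ltW.
by lra.
Unshelve. all: by end_near. Qed.

End horospherical_geodesic.

(** * Coarse geometry of the horospherical product *)

Section descending_chain.
Context {R : realType} (X : metricType R) (B : X -> R) (D : R).
Hypotheses (D0 : 0 <= D) (hB : horofunction B D).

(* A 1-Lipschitz path along which [B] grows linearly: the loss [D] in each
   ultrametric step is compensated by the growth of [B] over that step. *)
Lemma busemann_product_chain (n : nat) (y : R -> X) (b S : R) :
  0 <= S -> S <= (2 * D + 1) *+ n ->
  (forall s t, 0 <= s -> s <= t -> t <= S -> mdist (y s) (y t) <= t - s) ->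
  (forall s, 0 <= s -> s <= S -> b + s / 2 <= B (y s)) ->
  b - 2 * D - 1 <= busemann_product B (y 0) (y S).
Proof.
have Dge0 := D0; elim: n y b S => [|n ih] y b S S0 Sn yL yB.
  have -> : S = 0 by move: Sn; rewrite mulr0n; lra.
  have := yB 0 (lexx _) S0.
  by rewrite /busemann_product mdistxx; lra.
have [ST|TS] := leP S (2 * D + 1).
  have := yL 0 S (lexx _) S0 (lexx _); have := yB 0 (lexx _) S0.
  by have := yB S S0 (lexx _); rewrite /busemann_product; lra.
have T0 : 0 <= 2 * D + 1 by lra.
(* Over a step of length 2 D + 1 the lower bound for [B] rises by D + 1/2, more than the loss
   [D]. *)
have := ih (fun s => y (2 * D + 1 + s)) (b + (2 * D + 1) / 2) (S - (2 * D + 1)).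
rewrite addr0 (_ : 2 * D + 1 + (S - (2 * D + 1)) = S); last by lra.
have i1 : 0 <= S - (2 * D + 1) by lra.
have i2 : S - (2 * D + 1) <= (2 * D + 1) *+ n by rewrite lerBlDr -mulrSr.
move=> /(_ i1 i2) ihy.
have {}ihy : b + (2 * D + 1) / 2 - 2 * D - 1 <= busemann_product B (y (2 * D + 1)) (y S).
  apply: ihy => [s t s0 st tS|s s0 sS].
    have a1 : 0 <= 2 * D + 1 + s by lra.
    have a2 : 2 * D + 1 + s <= 2 * D + 1 + t by lra.
    have a3 : 2 * D + 1 + t <= S by lra.
    by have := yL _ _ a1 a2 a3; lra.
  have a1 : 0 <= 2 * D + 1 + s by lra.
  have a2 : 2 * D + 1 + s <= S by lra.
  by have := yB _ a1 a2; lra.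
have := horo_ultra hB (y 0) (y (2 * D + 1)) (y S).
have := yL 0 _ (lexx _) T0 (ltW TS); have := yB 0 (lexx _) S0; have := yB _ T0 (ltW TS).
move: ihy; rewrite /busemann_product; lra.
Qed.

Lemma busemann_product_path (y : R -> X) (b S : R) :
  0 <= S ->
  (forall s t, 0 <= s -> s <= t -> t <= S -> mdist (y s) (y t) <= t - s) ->
  (forall s, 0 <= s -> s <= S -> b + s / 2 <= B (y s)) ->
  b - 2 * D - 1 <= busemann_product B (y 0) (y S).
Proof.
have Dge0 := D0; move=> S0; have T0 : 0 < 2 * D + 1 by lra.
apply: (@busemann_product_chain (Num.truncn (S / (2 * D + 1))).+1) => //.
by rewrite -mulr_natr mulrC -ler_pdivrMr// ltW// truncnS_gt.
Qed.

(* The middle of the geodesic, at which the lower bound [b] for [B] is attained,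
   is where the vertical speed [K] changes sign. *)
Lemma vertical_speed (M : metricType R) (pi : M -> X) (K : R) (p q : M) :
  geodesic_space M -> 1 <= K <= 2 ->
  (forall r s, mdist (pi r) (pi s) <= mdist r s) ->
  (forall r s, K * (B (pi r) - B (pi s)) <= mdist r s) ->
  K * mdist (pi p) (pi q) <= mdist p q + 4 * (3 * D + 1).
Proof.
have Dge0 := D0; move=> gM /andP[K1 K2] piL piB; have [c cc] := geodesic_exists p q gM.
pose L := mdist p q; pose s0 := (K * (B (pi p) - B (pi q)) + L) / 2.
have K0 : 0 < K by lra.
have hpq := piB p q; have hqp := piB q p; rewrite (metric_sym q p) in hqp.
have hqp' : - (K * (B (pi p) - B (pi q))) <= L by rewrite -mulrN opprB.
rewrite -/L in hpq.
have s0L : 0 <= s0 <= L by rewrite /s0; lra.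
(* The Lipschitz bounds from [p] and [q] give K B >= K B(p) - s and K B >= K B(q) - (L - s) at
   parameter [s]; at [s0] both right-hand sides equal [K * b]. Moving away from [s0] the bound for B
   grows with slope 1 / K >= 1/2. *)
pose b := (B (pi p) + B (pi q) - L / K) / 2.
have Kb : K * b = (K * B (pi p) + K * B (pi q) - L) / 2.
  by rewrite /b; field; rewrite gt_eqF.
have Kdiv (a u : R) : 0 <= u -> K * b + u <= K * a -> b + u / 2 <= a.
  move=> u0 h; have : K * (b + u / 2) <= K * a by nra.
  by rewrite ler_pM2l.
have [c0 c1 _] := cc.
have left : b - 2 * D - 1 <= busemann_product B (pi (c s0)) (pi p).
  have := @busemann_product_path (fun s => pi (c (s0 - s))) b s0.
  rewrite subr0 subrr c0; apply.
  - by case/andP: s0L.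
  - move=> s t sp st ts; apply: le_trans (piL _ _) _.
    rewrite (geodesic_pathP cc); [|move: s0L; rewrite /L; lra..].
    by rewrite ler_norml; lra.
  - move=> s sp ss; apply: Kdiv => //.
    have := piB p (c (s0 - s)); rewrite (geodesic_path0 cc); last by move: s0L; rewrite /L; lra.
    by rewrite Kb /s0; lra.
have right : b - 2 * D - 1 <= busemann_product B (pi (c s0)) (pi q).
  have := @busemann_product_path (fun s => pi (c (s0 + s))) b (L - s0).
  rewrite addr0 subrKC c1; apply.
  - by case/andP: s0L; lra.
  - move=> s t sp st ts; apply: le_trans (piL _ _) _.
    rewrite (geodesic_pathP cc); [|move: s0L ts; rewrite /L; lra..].
    by rewrite ler_norml; lra.
  - move=> s sp ss; apply: Kdiv => //.
    have := piB q (c (s0 + s)); rewrite metric_sym (geodesic_path1 cc); last by move: s0L ss; rewrite /L; lra.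
    by rewrite Kb -/L /s0; lra.
have pq : b - 3 * D - 1 <= busemann_product B (pi p) (pi q).
  have := horo_ultra hB (pi p) (pi (c s0)) (pi q).
  by rewrite (busemann_productC B (pi p) (pi (c s0))); lra.
have : K * (b - 3 * D - 1) <= K * busemann_product B (pi p) (pi q) by rewrite ler_pM2l.
have : K * (3 * D + 1) <= 2 * (3 * D + 1) by rewrite ler_wpM2r//; lra.
rewrite /busemann_product !mulrBr Kb -/L => k1 k2.
by nra.
Qed.

End descending_chain.

Section horospherical_hyperbolic.
Context {R : realType} {X1 X2 : metricType R} {B1 : X1 -> R} {B2 : X2 -> R} {D : R}.
Variables (H1 : horospace B1 D) (H2 : horospace B2 D).
Local Notation Y := (horospherical_product B1 B2).
Local Notation M := (horo_prod H1 H2).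
Implicit Types (p q r : M).
Local Notation sqrt2 := (Num.sqrt (2 : R)).

Definition horo_busemann p : R := sqrt2 * B1 (hval p).1.
Local Notation BM := horo_busemann.

Lemma horo_busemann2 p : BM p = sqrt2 * B2 (hval p).2.
Proof. by have := hvalP p; rewrite /horo_busemann /horospherical_product/= => ->. Qed.

(** A difference of heights is at most the distance in each factor, hence twice its square is at
    most the square of the Euclidean distance. *)
Lemma horo_busemann_lip p q : BM p - BM q <= mdist p q.
Proof.
apply: le_trans (horo_euclidean p q).
have [neg|pos] := leP (B1 (hval p).1 - B1 (hval q).1) 0.
  apply: le_trans (euclidean_dist_ge0 _ _).
  by rewrite -mulrBr mulr_ge0_le0// sqrtr_ge0.
rewrite -(@ler_pXn2r _ 2) ?nnegrE ?euclidean_dist_ge0//; last first.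
  by rewrite -mulrBr mulr_ge0 ?sqrtr_ge0// ltW.
rewrite euclidean_dist_sqr -mulrBr exprMn sqr_sqrtr// mulr_natl mulr2n.
have h1 := horo_lip (horospace_horo H1) (hval p).1 (hval q).1.
have h2 := horo_lip (horospace_horo H2) (hval p).2 (hval q).2.
have Bp := hvalP p; have Bq := hvalP q.
rewrite /horospherical_product/= in Bp, Bq; rewrite -Bp -Bq in h2.
by rewrite lerD// ler_pXn2r// nnegrE ?mdist_ge0// ltW.
Qed.

(** A common bound for the errors of the two comparisons: 16 D from the detour, 6 D + 2 from the
    geodesics. *)
Let E := 20 * (D + 1).

Let D0 : 0 <= D. Proof. exact: horospace_ge0 H1. Qed.

Lemma horo_product_ge p q m : m <= busemann_product B1 (hval p).1 (hval q).1 ->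
  m <= busemann_product B2 (hval p).2 (hval q).2 ->
  sqrt2 * m - E <= busemann_product BM p q.
Proof.
move=> m1 m2; have := horo_le (joined_coarse H1 H2 (hvalP p) (hvalP q) m1 m2).
have : sqrt2 * D <= 2 * D by rewrite ler_wpM2r//; case/andP: (@sqrt2_bounds R).
have := D0.
by rewrite /busemann_product /horo_busemann /E; lra.
Qed.

Lemma horo_product_le1 p q :
  busemann_product BM p q <= sqrt2 * busemann_product B1 (hval p).1 (hval q).1 + E.
Proof.
have := @vertical_speed _ _ _ _ D0 (horospace_horo H1) M (fun p => (hval p).1) _ p q
  (@horo_geodesic _ _ _ _ _ _ H1 H2) (@sqrt2_bounds R) (@horo_dist1 _ _ _ _ _ _ H1 H2).
have h r s : sqrt2 * (B1 (hval r).1 - B1 (hval s).1) <= mdist r s.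
  by rewrite mulrBr; exact: horo_busemann_lip.
move=> /(_ h); have := D0.
by rewrite /busemann_product /horo_busemann /E; lra.
Qed.

Lemma horo_product_le2 p q :
  busemann_product BM p q <= sqrt2 * busemann_product B2 (hval p).2 (hval q).2 + E.
Proof.
have := @vertical_speed _ _ _ _ D0 (horospace_horo H2) M (fun p => (hval p).2) _ p q
  (@horo_geodesic _ _ _ _ _ _ H1 H2) (@sqrt2_bounds R) (@horo_dist2 _ _ _ _ _ _ H1 H2).
have h r s : sqrt2 * (B2 (hval r).2 - B2 (hval s).2) <= mdist r s.
  by rewrite mulrBr -!horo_busemann2; exact: horo_busemann_lip.
move=> /(_ h); have := D0.
by rewrite /busemann_product !horo_busemann2 /E; lra.
Qed.

(** The ultrametric inequality is used only in the factor realising the minimum for p and r; it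
    costs 2 D after scaling, and the comparison with this factor costs [E] twice. *)
Lemma horo_busemann_horofunction : horofunction BM (50 * (D + 1)).
Proof.
split; first exact: horo_busemann_lip.
have [s1 s2] := andP (@sqrt2_bounds R).
have sm (a b : R) : a - D <= b -> sqrt2 * a - 2 * D <= sqrt2 * b.
  move=> ab; have : sqrt2 * (a - D) <= sqrt2 * b by rewrite ler_wpM2l//; lra.
  have : sqrt2 * D <= 2 * D by rewrite ler_wpM2r.
  by lra.
move=> p q r; have hE : E = 20 * (D + 1) by [].
have [le12|/ltW le21] := leP (busemann_product B1 (hval p).1 (hval r).1)
  (busemann_product B2 (hval p).2 (hval r).2).
- have := horo_product_ge (lexx _) le12.
  have := horo_product_le1 p q; have := horo_product_le1 q r.
  by have [/sm|/sm] := horo_ultra (horospace_horo H1) (hval p).1 (hval q).1 (hval r).1;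
    [left|right]; have := D0; lra.
- have := horo_product_ge le21 (lexx _).
  have := horo_product_le2 p q; have := horo_product_le2 q r.
  by have [/sm|/sm] := horo_ultra (horospace_horo H2) (hval p).2 (hval q).2 (hval r).2;
    [left|right]; have := D0; lra.
Qed.

Lemma horo_hyperbolic : proper_geodesic_hyperbolic M.
Proof.
split; [exact: horo_proper|exact: horo_geodesic|].
exists (3 * (2 * (50 * (D + 1)))); first by have := D0; lra.
exact/gromov_delta_hyperbolic/horofunction_gromov/horo_busemann_horofunction.
Qed.

End horospherical_hyperbolic.

(** * Boundary at infinity *)

Section eventually_ge.
Context {R : realType} (T : Type).
Implicit Types (f : T -> T -> R) (x y w : nat -> T) (r s : R).

(** A lower bound on the inferior limit of f(x k, y l), without extended reals; [unbounded] is
    divergence to infinity. *)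
Definition eventually_ge f x y r : Prop :=
  exists N, forall k l, (N <= k)%N -> (N <= l)%N -> r <= f (x k) (y l).

Definition unbounded f x y : Prop := forall r, eventually_ge f x y r.

Lemma eventually_ge_le f x y r s :
  eventually_ge f x y r -> s <= r -> eventually_ge f x y s.
Proof. by move=> [N hN] sr; exists N => k l Nk Nl; apply: le_trans sr _; exact: hN. Qed.

Context (f : T -> T -> R) (D : R).
Hypotheses (fC : forall a b, f a b = f b a) (hf : quasi_ultrametric D f).

Lemma eventually_ge_sym x y r : eventually_ge f x y r -> eventually_ge f y x r.
Proof. by move=> [N hN]; exists N => k l Nk Nl; rewrite fC hN. Qed.

Lemma unbounded_sym x y : unbounded f x y -> unbounded f y x.
Proof. by move=> h r; exact: eventually_ge_sym. Qed.

Lemma eventually_ge_trans y x w r : eventually_ge f x y r ->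
  eventually_ge f y w r -> eventually_ge f x w (r - D).
Proof.
move=> [N1 h1] [N2 h2]; exists (maxn N1 N2) => k l.
rewrite !geq_max => /andP[k1 k2] /andP[l1 l2].
have := h1 k (maxn N1 N2) k1 (leq_maxl _ _); have := h2 (maxn N1 N2) l (leq_maxr _ _) l2.
by have := hf (x k) (y (maxn N1 N2)) (w l); lra.
Qed.

Lemma unbounded_trans y x w : unbounded f x y -> unbounded f y w -> unbounded f x w.
Proof.
by move=> xy yw r; rewrite -(addrK D r); exact: eventually_ge_trans (xy _) (yw _).
Qed.

End eventually_ge.

Section sequences_at_infinity.
Context {R : realType} (X : metricType R) (z : X).
Implicit Types (x y w : nat -> X) (r : R).
Local Notation gromov_eventually := (eventually_ge (gromov_product z)).
Local Notation gromov_unbounded := (unbounded (gromov_product z)).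

Lemma liminf_gromov_ge x y r :
  gromov_eventually x y r -> (r%:E <= liminf_gromov z x y)%E.
Proof.
move=> [N hN]; rewrite /liminf_gromov limf_einfE.
pose V := [set kl : nat * nat | (N <= kl.1)%N /\ (N <= kl.2)%N].
apply: le_trans (_ : (ereal_inf ((fun kl => (gromov_product z (x kl.1) (y kl.2))%:E) @` V) <= _)%E).
  by apply: le_ereal_inf_tmp => _ [[k l] [Nk Nl] <-]; rewrite lee_fin hN.
apply: ereal_sup_ubound; exists V => //.
exists ([set k | (N <= k)%N], [set k | (N <= k)%N]) => /=; last by move=> [k l] [].
by split; exists N.
Qed.

Lemma gromov_eventually_lt x y r :
  (r%:E < liminf_gromov z x y)%E -> gromov_eventually x y r.
Proof.
rewrite /liminf_gromov limf_einfE => /ereal_sup_gt[_ [V VF <-] rV].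
have [[P Q] /= [[N1 _ hP] [N2 _ hQ]] PQV] := VF.
exists (maxn N1 N2) => k l; rewrite !geq_max => /andP[k1 _] /andP[_ l2].
rewrite -lee_fin; apply/ltW/(lt_le_trans rV)/ereal_inf_lbound.
by exists (k, l) => //; apply: PQV; split; [exact: hP|exact: hQ].
Qed.

Lemma liminf_gromov_pinftyP x y : liminf_gromov z x y = +oo%E <-> gromov_unbounded x y.
Proof.
split=> [h r|h]; first by apply: gromov_eventually_lt; rewrite h ltry.
by apply: eq_infty => r; exact: liminf_gromov_ge.
Qed.

Lemma class_at_infinityE x y : class_at_infinity z x y <->
  gromov_unbounded y y /\ gromov_unbounded x y.
Proof.
by split=> -[/liminf_gromov_pinftyP h1 /liminf_gromov_pinftyP h2].
Qed.

Lemma represents_unbounded x (v : boundary z) : represents x v -> gromov_unbounded x x.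
Proof. by case=> /liminf_gromov_pinftyP. Qed.

Lemma represents_exists (v : boundary z) : exists x, represents x v.
Proof.
by case: v => A Ap; have [x hx AE] := set_mem Ap; exists x; split; rewrite ?AE.
Qed.

Lemma boundary_exists x : gromov_unbounded x x -> exists v : boundary z, represents x v.
Proof.
move=> hx; have xP : [set A : set (nat -> X) | exists2 y, converges_to_infinity z y &
    A = class_at_infinity z y] (class_at_infinity z x).
  by exists x => //; exact/liminf_gromov_pinftyP.
by exists (exist _ (class_at_infinity z x) (mem_set xP) : boundary z); split=> //; exact/liminf_gromov_pinftyP.
Qed.

Context (D : R) (D0 : 0 <= D) (hX : gromov_hyperbolic X D).

Let gromov_trans := eventually_ge_trans (hX z).
Let gromov_sym := eventually_ge_sym (gromov_productC z).

Lemma representsP x y (v w : boundary z) : represents x v -> represents y w ->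
  v = w <-> gromov_unbounded x y.
Proof.
move=> [/liminf_gromov_pinftyP xx xv] [/liminf_gromov_pinftyP yy yw]; split=> [vw|xy].
  suff : class_at_infinity z x y by case/class_at_infinityE.
  by rewrite xv vw -yw; apply/class_at_infinityE.
apply: val_inj; rewrite -xv -yw; apply/seteqP.
split=> t /class_at_infinityE[tt h]; apply/class_at_infinityE; split=> //.
  apply: (unbounded_trans (hX z)) h; exact: (unbounded_sym (gromov_productC z)).
exact: (unbounded_trans (hX z)) xy h.
Qed.

Lemma represents_of x y (v : boundary z) : represents x v -> gromov_unbounded y y ->
  gromov_unbounded x y -> represents y v.
Proof.
move=> xv yy xy; have [w yw] := boundary_exists yy.
by rewrite ((representsP xv yw).2 xy).
Qed.

Lemma boundary_nbhdI x y (v w : boundary z) r : represents x v -> represents y w ->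
  gromov_eventually x y r -> boundary_nbhd v r w.
Proof. by move=> xv yw xy; exists x, y; split=> //; exact: liminf_gromov_ge. Qed.

(** The neighbourhood only asserts that suitable representatives exist. Replacing them by given ones
    costs [D] at each end; the 1 turns a bound on the inferior limit into an eventual one. *)
Lemma boundary_nbhdE x y (v w : boundary z) r : represents x v -> represents y w ->
  boundary_nbhd v r w -> gromov_eventually x y (r - 1 - 2 * D).
Proof.
move=> xv yw [x' [y' [xv' yw' rxy]]].
have xy' : gromov_eventually x' y' (r - 1).
  by apply: gromov_eventually_lt; apply: lt_le_trans rxy; rewrite lte_fin; lra.
have xx' := (representsP xv xv').1 erefl.
have yy' := (representsP yw' yw).1 erefl.
have := gromov_trans (gromov_trans (xx' (r - 1)) xy') (yy' (r - 1 - D)).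
by move/eventually_ge_le; apply; lra.
Qed.

Lemma boundary_nbhd_refl (v : boundary z) r : boundary_nbhd v r v.
Proof.
have [x xv] := represents_exists v.
by apply: (boundary_nbhdI xv xv); exact: represents_unbounded xv r.
Qed.

Lemma boundary_nbhd_trans (w v t : boundary z) r : boundary_nbhd v r w ->
  boundary_nbhd w r t -> boundary_nbhd v (r - 1 - 3 * D) t.
Proof.
have [x xv] := represents_exists v; have [y yw] := represents_exists w.
have [u ut] := represents_exists t.
move=> /(boundary_nbhdE xv yw) h1 /(boundary_nbhdE yw ut) h2.
apply: (boundary_nbhdI xv ut).
by apply: (eventually_ge_le (gromov_trans h1 h2)); lra.
Qed.

(** The set itself may fail to be open; the points [w] having some [boundary_nbhd w s] inside it
    form an open set, by quasi-transitivity with radius s + 1 + 3 D. *)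
Lemma nbhs_boundary_nbhd (v : boundary z) r : 0 < r -> nbhs v (boundary_nbhd v r).
Proof.
have Dge0 := D0.
move=> r0; rewrite nbhsE; pose V := [set w | exists2 s : R, 0 < s & boundary_nbhd w s `<=` boundary_nbhd v r].
exists V; last by move=> w [s s0]; apply; exact: boundary_nbhd_refl.
split; last by exists r.
move=> w [s s0 sV]; exists (s + (1 + 3 * D)); first by lra.
move=> t wt; exists (s + (1 + 3 * D)); first by lra.
move=> u tu; apply: sV; have := boundary_nbhd_trans wt tu.
by apply: boundary_nbhd_le; lra.
Qed.

Lemma nbhs_boundaryP (v : boundary z) (W : set (boundary z)) :
  nbhs v W <-> exists2 r, 0 < r & boundary_nbhd v r `<=` W.
Proof.
split=> [|[r r0 rW]]; last by apply: filterS rW _; exact: nbhs_boundary_nbhd.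
rewrite nbhsE => -[V [oV Vv] VW]; have [r r0 rV] : exists2 r, 0 < r & boundary_nbhd v r `<=` V.
  exact: oV.
by exists r => // w /rV/VW.
Qed.

(** Points whose neighbourhoods of every radius meet have representatives with unbounded Gromov
    product. *)
Lemma boundary_hausdorff : hausdorff_space (boundary z).
Proof.
have Dge0 := D0.
move=> v w vw; have [x xv] := represents_exists v; have [y yw] := represents_exists w.
apply/(representsP xv yw) => r.
pose s := Num.max 1 (r + 1 + 3 * D).
have s0 : 0 < s by rewrite /s lt_max ltr01.
have rs : r + 1 + 3 * D <= s by rewrite /s le_max lexx orbT.
have [t [vt wt]] := vw _ _ (nbhs_boundary_nbhd v s0) (nbhs_boundary_nbhd w s0).
have [u ut] := represents_exists t.
have h1 := boundary_nbhdE xv ut vt.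
have h2 := gromov_sym (boundary_nbhdE yw ut wt).
by apply: (eventually_ge_le (gromov_trans h1 h2)); lra.
Qed.

(* Points at distance [T] from [z] on geodesics towards the points of the
   boundary converge along an ultrafilter, for every [T]. *)
Lemma boundary_compact : proper_space X -> geodesic_space X ->
  compact [set: boundary z].
Proof.
have Dge0 := D0.
move=> pX gX; rewrite compact_ultra => F FU _.
have /choice[x xP] (v : boundary z) := represents_exists v.
have /choice[P PP] (vT : boundary z * nat) : exists p, mdist z p = vT.2%:R /\
    exists N, forall k, (N <= k)%N -> vT.2%:R - D <= gromov_product z p (x vT.1 k).
  case: vT => v T /=; have [N hN] := represents_unbounded (xP v) T%:R.
  have [A hA] := gX z (x v N).
  have zx : T%:R <= mdist z (x v N).
    have := hN N N (leqnn _) (leqnn _).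
    by rewrite /gromov_product mdistxx (metric_sym _ z); lra.
  have [|p _ [zp px]] := geodesic_segmentP (s := T%:R) hA; first by rewrite ler0n.
  exists p; split=> //; exists N => k Nk.
  have := hN N k (leqnn _) Nk; have := hX z p (x v N) (x v k).
  have : gromov_product z p (x v N) = T%:R.
    by rewrite /gromov_product px (metric_sym p) zp (metric_sym _ z); lra.
  lra.
have PPP v S T r : r <= S%:R -> r <= T%:R -> r - 2 * D <= gromov_product z (P (v, S)) (P (v, T)).
  move=> rS rT; have [_ [N1 h1]] := PP (v, S); have [_ [N2 h2]] := PP (v, T).
  have := h1 (maxn N1 N2) (leq_maxl _ _); have := h2 (maxn N1 N2) (leq_maxr _ _).
  rewrite /= (gromov_productC z (P (v, T))).
  by have := hX z (P (v, S)) (x v (maxn N1 N2)) (P (v, T)); lra.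
have /choice[y yP] (T : nat) : exists p, forall e, 0 < e ->
    \forall v \near F, mdist p (P (v, T)) < e.
  apply: (@ultra_limit _ _ pX _ F FU (fun v => P (v, T)) z T%:R).
  by apply: filterE => v; have [-> _] := PP (v, T).
have yy S T r : r <= S%:R -> r <= T%:R -> r - 2 * D - 1 <= gromov_product z (y S) (y T).
  move=> rS rT; have h2 : 0 < 2^-1 :> R by lra.
  near F => v; have := PPP v _ _ _ rS rT.
  have : mdist (y S) (P (v, S)) < 2^-1 by near: v; exact: yP.
  have : mdist (y T) (P (v, T)) < 2^-1 by near: v; exact: yP.
  have := metric_triangle (P (v, S)) (y S) z; have := metric_triangle (P (v, T)) (y T) z.
  have := metric_triangle (y S) (P (v, S)) (y T).
  have := metric_triangle (P (v, S)) (P (v, T)) (y T).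
  rewrite /gromov_product (metric_sym (P (v, T)) (y T)) (metric_sym (P (v, S)) (y S)).
  by lra.
have yun : gromov_unbounded y y.
  move=> r; exists (Num.truncn (r + 2 * D + 1)).+1 => k l Nk Nl.
  have nat_ge n : ((Num.truncn (r + 2 * D + 1)).+1 <= n)%N -> r + 2 * D + 1 <= n%:R.
    move=> h; apply/ltW/(lt_le_trans (truncnS_gt _)).
    by rewrite ler_nat.
  by have := yy k l _ (nat_ge _ Nk) (nat_ge _ Nl); lra.
have [w yw] := boundary_exists yun.
exists w; split=> // W /nbhs_boundaryP[r r0 rW].
(* Passing from [y k] through [y T] and [P (v, T)] to [x v l] loses at most 4 D + 1. *)
pose T := (Num.truncn (r + 4 * D + 1)).+1.
have rT : r + 4 * D + 1 <= T%:R by exact/ltW/truncnS_gt.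
apply: filterS (yP T 1 ltr01) => v yv; apply: rW.
apply: (boundary_nbhdI yw (xP v)).
have [zP [N hN]] := PP (v, T).
exists (maxn T N) => k l; rewrite !geq_max => /andP[Tk _] /andP[_ Nl].
have Tk' : (T%:R : R) <= k%:R by rewrite ler_nat.
have := yy k T T%:R Tk' (lexx _); have := hN l Nl => /=.
have := hX z (y k) (y T) (x v l); have := hX z (y T) (P (v, T)) (x v l).
have : T%:R - 1 <= gromov_product z (y T) (P (v, T)).
  rewrite /gromov_product; have := metric_triangle z (y T) (P (v, T)).
  by rewrite zP /= (metric_sym (P _) z) zP (metric_sym (y T) z) /=; lra.
lra.
Unshelve. all: by end_near. Qed.

End sequences_at_infinity.

(** * Gromov products and the centre of a horofunction *)

Section centers.
Context {R : realType} (X : metricType R) (B : X -> R) (D : R) (z : X).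
Hypotheses (D0 : 0 <= D) (hB : horofunction B D).
Implicit Types (x y w : nat -> X) (r A : R).
Local Notation gp := (gromov_product z).
Local Notation bp := (busemann_product B).

(* The Gromov product based at [z] of a point and the centre of [B]. *)
Definition center_product (a : X) : R := 2^-1 * (mdist a z - B a + B z).
Local Notation cp := center_product.

Lemma center_product_ge0 a : 0 <= cp a.
Proof. by have := horo_lip hB a z; rewrite /center_product; lra. Qed.

Lemma center_productE a : cp a = B z - bp a z.
Proof. by rewrite /center_product /busemann_product; lra. Qed.

(** This identity translates between basepoint and centre: where [cp] is bounded, [gp] and [bp]
    differ by a bounded amount. *)
Lemma gromov_center a b : gp a b = bp a b + cp a + cp b - B z.
Proof. by rewrite /center_product /busemann_product /gromov_product; lra. Qed.

(** This is the ultrametric inequality of [bp] with [z] as one of the three points, read as an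
    inequality for the points a, b and the centre seen from [z]. *)
Lemma center_ultra a b : cp a - D <= cp b \/ gp a b - D <= cp b.
Proof.
have := horo_ultra hB a b z.
by rewrite gromov_center !center_productE; lra.
Qed.

Lemma gromov_ultra_center a b : cp a - D <= gp a b \/ cp b - D <= gp a b.
Proof.
have := horo_ultra hB a z b.
by rewrite (busemann_productC B z) gromov_center !center_productE; lra.
Qed.

Definition center_ge x r : Prop := exists N, forall k, (N <= k)%N -> r <= cp (x k).
Definition centered x : Prop := forall r, center_ge x r.
Definition center_le x A : Prop := exists N, forall k, (N <= k)%N -> cp (x k) <= A.

Lemma gromov_centered x y r : centered x -> center_ge y r ->
  eventually_ge gp x y (r - D).
Proof.
move=> /(_ r)[N1 h1] [N2 h2]; exists (maxn N1 N2) => k l.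
rewrite !geq_max => /andP[k1 _] /andP[_ l2].
by have := h1 k k1; have := h2 l l2; have := gromov_ultra_center (x k) (y l); lra.
Qed.

Lemma centered_gromov x y r : centered x -> eventually_ge gp x y r ->
  center_ge y (r - D).
Proof.
move=> /(_ r)[N1 h1] [N2 h2]; exists N2 => l Nl.
have := h1 (maxn N1 N2) (leq_maxl _ _).
have := h2 (maxn N1 N2) l (leq_maxr _ _) Nl.
by have := center_ultra (x (maxn N1 N2)) (y l); lra.
Qed.

Lemma centered_unbounded x : centered x -> unbounded gp x x.
Proof. by move=> hx r; rewrite -(addrK D r); exact: gromov_centered. Qed.

Lemma center_le_centered x A : center_le x A -> ~ centered x.
Proof.
move=> [N1 h1] /(_ (A + 1))[N2 h2].
have := h1 _ (leq_maxl N1 N2); have := h2 _ (leq_maxr N1 N2); lra.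
Qed.

Lemma center_le_gromov x y r A : eventually_ge gp x y r -> center_le x A ->
  A + D < r -> center_le y (A + D).
Proof.
move=> [N1 h1] [N2 h2] Ar; exists (maxn N1 N2) => l.
rewrite geq_max => /andP[l1 _].
have := h1 _ l (leq_maxl N1 N2) l1; have := h2 _ (leq_maxr N1 N2).
have := center_ultra (y l) (x (maxn N1 N2)); rewrite (gromov_productC z (y l)); lra.
Qed.

(** Late terms have large mutual Gromov products, so a single late term with small [cp] bounds [cp]
    on all the others. *)
Lemma not_centered x : unbounded gp x x -> ~ centered x ->
  exists2 A, 0 <= A & center_le x A.
Proof.
move=> xx nx; have [r /forallNP nr] : exists r, ~ center_ge x r by exact/existsNP.
have [N hN] := xx (r + D); exists (Num.max 0 (r + D)); first by rewrite le_max lexx.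
exists N => l Nl; rewrite le_max; apply/orP; right.
have /existsNP[k /not_implyP[Nk /negP]] := nr N; rewrite -ltNge => xk.
have := hN l k Nl Nk; have := center_ultra (x l) (x k); lra.
Qed.

Lemma busemann_center_le x : unbounded bp x x -> exists A, center_le x A.
Proof.
move=> /(_ (B z))[N hN]; exists (B z - (bp (x N) z - D)), N => l Nl.
have := hN N l (leqnn _) Nl; have := horo_ultra hB (x l) (x N) z.
have := busemann_product_le z (x N) hB; rewrite (busemann_productC B z).
by rewrite (busemann_productC B (x l) (x N)) center_productE; lra.
Qed.

Lemma busemann_gromov x y r : eventually_ge bp x y r -> eventually_ge gp x y (r - B z).
Proof.
move=> [N hN]; exists N => k l Nk Nl; have := hN k l Nk Nl.
have := center_product_ge0 (x k); have := center_product_ge0 (y l).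
by rewrite gromov_center; lra.
Qed.

Lemma unbounded_busemann_gromov x y : unbounded bp x y -> unbounded gp x y.
Proof. by move=> h r; rewrite -(addrK (B z) r); exact: busemann_gromov. Qed.

Lemma gromov_busemann x y r A : eventually_ge gp x y r -> center_le x A ->
  A + D < r -> eventually_ge bp x y (r - 2 * A - D + B z).
Proof.
move=> xy xA Ar; have [N2 h2] := center_le_gromov xy xA Ar.
have [N1 h1] := xA; have [N hN] := xy; exists (maxn N (maxn N1 N2)) => k l.
rewrite !geq_max => /and3P[k0 k1 _] /and3P[l0 _ l2].
have := hN k l k0 l0; have := h1 k k1; have := h2 l l2.
by rewrite gromov_center; lra.
Qed.

Lemma unbounded_gromov_busemann x y A :
  unbounded gp x y -> center_le x A -> unbounded bp x y.
Proof.
have Dge0 := D0.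
move=> xy xA r; pose s := Num.max (A + D + 1) (r + 2 * A + D - B z).
have s1 : A + D + 1 <= s by rewrite /s le_max lexx.
have s2 : r + 2 * A + D - B z <= s by rewrite /s le_max lexx orbT.
by apply: (eventually_ge_le (gromov_busemann (xy s) xA _)); lra.
Qed.

Section boundary_point.
Context (u : boundary z) (c : nat -> X).
Hypotheses (cu : represents c u) (cc : centered c).

Let hX := horofunction_gromov hB.

Lemma centeredP x (v : boundary z) : represents x v -> v = u <-> centered x.
Proof.
move=> xv; rewrite (representsP hX xv cu); split=> h.
  move=> r; rewrite -(addrK D r); apply: centered_gromov cc _.
  by apply: unbounded_sym h _; exact: gromov_productC.
by move=> r; rewrite -(addrK D r); apply: gromov_centered h _; exact: cc.
Qed.

Lemma off_center x (v : boundary z) : represents x v -> v <> u ->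
  exists2 A, 0 <= A & center_le x A.
Proof.
move=> xv vu; apply: not_centered; first exact: represents_unbounded xv.
by move/(centeredP xv).
Qed.

Lemma off_center_unbounded x (v : boundary z) : represents x v -> v <> u ->
  unbounded bp x x.
Proof.
move=> xv /(off_center xv)[A _ xA].
exact: unbounded_gromov_busemann (represents_unbounded xv) xA.
Qed.

Lemma unbounded_off_center x (v : boundary z) : represents x v ->
  unbounded bp x x -> v <> u.
Proof.
by move=> xv /busemann_center_le[A xA] /(centeredP xv); exact: center_le_centered xA.
Qed.

Lemma unbounded_eq x y (v w : boundary z) : represents x v -> represents y w ->
  unbounded bp x y -> v = w.
Proof.
by move=> xv yw xy; apply/(representsP hX xv yw)/unbounded_busemann_gromov.
Qed.

Lemma off_center_equiv x y (v : boundary z) : represents x v -> represents y v ->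
  v <> u -> unbounded bp x y.
Proof.
move=> xv yv /(off_center xv)[A _ xA].
exact: unbounded_gromov_busemann ((representsP hX xv yv).1 erefl) xA.
Qed.

Lemma unbounded_represents x y (v : boundary z) : represents x v ->
  unbounded bp x y -> represents y v.
Proof.
move=> xv xy; have yx := unbounded_sym (busemann_productC B) xy.
apply: (represents_of hX xv); apply: unbounded_busemann_gromov => //.
exact: (unbounded_trans (horo_ultra hB)) yx xy.
Qed.

(** X is Gromov hyperbolic with constant 2 D, so the neighbourhood gives the product r - 1 - 4 D;
    the condition on [r] makes this exceed A + D, which keeps [y] away from the centre. *)
Lemma off_center_nbhd x y (v w : boundary z) A r : represents x v -> represents y w ->
  center_le x A -> boundary_nbhd v r w -> A + 5 * D + 1 < r ->
  w <> u /\ eventually_ge bp x y (r - 1 - 5 * D - 2 * A + B z).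
Proof.
have Dge0 := D0.
move=> xv yw xA vw rA; have xy := boundary_nbhdE hX xv yw vw.
have rA' : A + D < r - 1 - 2 * (2 * D) by lra.
split.
  by move=> /(centeredP yw); exact: center_le_centered (center_le_gromov xy xA rA').
by apply: (eventually_ge_le (gromov_busemann xy xA rA')); lra.
Qed.

Lemma center_nbhd y (w : boundary z) r : represents y w -> boundary_nbhd u r w ->
  center_ge y (r - 1 - 5 * D).
Proof.
move=> yw uw; have := centered_gromov cc (boundary_nbhdE hX cu yw uw).
by move=> [N hN]; exists N => k /hN; lra.
Qed.

End boundary_point.

End centers.

Section busemann_horospace.
Context {R : realType} (X : metricType R) (B : X -> R) (z : X) (u : boundary z).

(** The constant can be enlarged at will, so that two factors can share one. *)
Lemma busemann_horospace : proper_geodesic_hyperbolic X -> busemann_function u B ->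
  exists D, forall D', D <= D' -> horospace B D'.
Proof.
move=> [pX gX [d d0 hd]] [rho [rhoP _ rhoB]].
have hX := delta_hyperbolic_gromov d0 gX hd.
exists (d + 2 * (d + 1)) => D' DD'; split=> //; first by lra.
  have [hlip hul] := busemann_horofunction rhoB hX.
  by split=> // x y v; have := hul x y v; lra.
exact: (busemann_ascending rhoP rhoB pX gX hX).
Qed.

(** The explicit heights [- k%:R] are the same for every Busemann function, so two such sequences
    pair up to points of the horospherical product. *)
Lemma busemann_centered : busemann_function u B -> exists c : nat -> X,
  [/\ represents c u, centered B z c & forall k, B (c k) = - k%:R].
Proof.
move=> [rho [rhoP rhou rhoB]]; exists (fun k => rho k%:R).
have Bc k : B (rho k%:R) = - k%:R by rewrite (busemann_ray rhoP rhoB) ?ler0n.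
split=> // r; exists (Num.truncn (2 * r - B z)).+1 => k hk.
have : 2 * r - B z <= k%:R by apply/ltW/(lt_le_trans (truncnS_gt _)); rewrite ler_nat.
by rewrite /center_product Bc; have := mdist_ge0 (rho k%:R) z; lra.
Qed.

End busemann_horospace.

(** * The smash product as a topological quotient *)

Section smash_homeomorphism.
Local Open Scope quotient_scope.

Lemma smash_homeomorphism (U1 U2 Z : topologicalType) (u1 : U1) (u2 : U2)
    (G : U1 * U2 -> Z) :
  compact [set: U1] -> compact [set: U2] -> hausdorff_space Z -> continuous G ->
  (forall z, exists v, G v = z) ->
  (forall a b, G a = G b <-> smash_rel u1 u2 a b) ->
  exists h : Z -> smash u1 u2, homeomorphism h.
Proof.
move=> c1 c2 hZ cG /choice[g gK] GE.
pose k : smash u1 u2 -> Z := G \o repr.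
pose p : U1 * U2 -> smash u1 u2 := \pi_(smash u1 u2).
have pE a b : (p a = p b) <-> smash_rel u1 u2 a b.
  by split=> [/eqmodP|h]; last exact/eqmodP.
have kp a : k (p a) = G a by apply/GE/pE; rewrite /p reprK.
have ck : continuous k.
  apply: repr_comp_continuous => // a b /eqP/pE/GE ->; exact: eqxx.
have cp : continuous p by exact: pi_continuous.
have hk : cancel (p \o g) k by move=> x /=; rewrite kp gK.
have kh : cancel k (p \o g).
  move=> s /=; rewrite -[RHS]reprK; apply/pE/GE; exact: gK.
exists (p \o g); split; last by exists k.
have cS : compact [set: smash u1 u2].
  have -> : [set: smash u1 u2] = p @` [set: U1 * U2].
    by apply/seteqP; split => // s _; exists (repr s) => //; exact: reprK.
  apply: continuous_compact; first exact: continuous_subspaceT.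
  by rewrite -setXTT; exact: compact_setX.
apply/continuous_closedP => C cC.
(* The inverse of the continuous bijection [k] is continuous because [k] maps closed, hence compact,
   sets to compact sets of a Hausdorff space. *)
have -> : (p \o g) @^-1` C = k @` C.
  apply/seteqP; split => x /=; first by move=> Cx; exists (p (g x)) => //; exact: hk.
  by move=> [s Cs <-]; have := kh s => /= ->.
apply: compact_closed => //; apply: continuous_compact; first exact: continuous_subspaceT.
by apply: subclosed_compact cS _.
Qed.

End smash_homeomorphism.

(** * The boundary of the horospherical product *)

Section factor.
Context {R : realType} (M X : metricType R) (BM : M -> R) (B : X -> R).
Context (pi : M -> X) (K E : R) (z : M) (zX : X).
Hypotheses (K1 : 1 <= K) (BMpi : forall p, BM p = K * B (pi p)).
Hypothesis le_pi : forall p q,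
  busemann_product BM p q <= K * busemann_product B (pi p) (pi q) + E.

Lemma center_product_base (D : R) (a b x : X) : horofunction B D ->
  center_product B a x - mdist a b <= center_product B b x.
Proof.
move=> hB; have := horo_lip hB a b; have := metric_triangle x b a.
by rewrite /center_product (metric_sym b a); lra.
Qed.

(** The basepoints [zX] and [pi z] are unrelated; replacing one by the other costs at most their
    distance. *)
Lemma center_product_factor (D : R) (q : M) t : horofunction B D -> 0 <= E -> 0 <= t ->
  t + mdist zX (pi z) + E <= center_product B zX (pi q) -> t <= center_product BM z q.
Proof.
move=> hB E0 t0 h; have := center_product_base zX (pi z) (pi q) hB.
have := le_pi q z; rewrite !center_productE BMpi => h1 h2.
have h3 : t + E <= B (pi z) - busemann_product B (pi q) (pi z).
  by move: h h2; rewrite !center_productE; lra.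
have h4 : t + E <= K * (B (pi z) - busemann_product B (pi q) (pi z)).
  by apply: (le_trans h3); rewrite ler_peMl//; have := K1; lra.
by rewrite mulrBr in h4; lra.
Qed.

Lemma unbounded_factor (p q : nat -> M) :
  unbounded (busemann_product BM) p q ->
  unbounded (busemann_product B) (pi \o p) (pi \o q).
Proof.
have K0 : 0 < K by have := K1; lra.
move=> pq r; have [N hN] := pq (K * r + E); exists N => k l Nk Nl.
have := hN k l Nk Nl; have := le_pi (p k) (q l) => h1 h2.
by rewrite -(ler_pM2l K0) /=; lra.
Qed.

End factor.

Section boundary_map.
Context {R : realType} {X1 X2 : metricType R} {B1 : X1 -> R} {B2 : X2 -> R} {D : R}.
Variables (H1 : horospace B1 D) (H2 : horospace B2 D).
Local Notation M := (horo_prod H1 H2).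
Context (z : M) (z1 : X1) (z2 : X2) (u1 : boundary z1) (u2 : boundary z2).
Context (c1 : nat -> X1) (c2 : nat -> X2).
Hypotheses (cu1 : represents c1 u1) (cu2 : represents c2 u2).
Hypotheses (cc1 : centered B1 z1 c1) (cc2 : centered B2 z2 c2).
Hypothesis Bc : forall k, B1 (c1 k) = B2 (c2 k).
Implicit Types (v w : boundary z1 * boundary z2) (xi eta : boundary z) (p q : nat -> M).

Local Notation BM := (@horo_busemann R X1 X2 B1 B2 D H1 H2).
Local Notation DM := (50 * (D + 1)).
Local Notation E := (20 * (D + 1)).
Local Notation pi1 p := (fun k => (hval (p k : M)).1).
Local Notation pi2 p := (fun k => (hval (p k : M)).2).
Local Notation sqrt2 := (Num.sqrt (2 : R)).

Let D0 : 0 <= D. Proof. exact: horospace_ge0 H1. Qed.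
Let DM0 : 0 <= DM. Proof. by have := D0; lra. Qed.
Let E0 : 0 <= E. Proof. by have := D0; lra. Qed.
Let h1 := horospace_horo H1.
Let h2 := horospace_horo H2.
Let hM : horofunction BM DM := horo_busemann_horofunction H1 H2.
Let gM : gromov_hyperbolic M (2 * DM) := horofunction_gromov hM.
Let K1 : 1 <= sqrt2. Proof. by case/andP: (@sqrt2_bounds R). Qed.

Let centerM1 (a : M) t : 0 <= t ->
  t + mdist z1 (hval z).1 + E <= center_product B1 z1 (hval a).1 ->
  t <= center_product BM z a.
Proof.
exact: (center_product_factor (pi := fun a : M => (hval a).1) K1 (fun=> erefl)
  (@horo_product_le1 _ _ _ _ _ _ H1 H2) h1 E0).
Qed.

Let centerM2 (a : M) t : 0 <= t ->
  t + mdist z2 (hval z).2 + E <= center_product B2 z2 (hval a).2 ->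
  t <= center_product BM z a.
Proof.
exact: (center_product_factor (pi := fun a : M => (hval a).2) K1
  (@horo_busemann2 _ _ _ _ _ _ H1 H2) (@horo_product_le2 _ _ _ _ _ _ H1 H2) h2 E0).
Qed.

Let unboundedM1 p q : unbounded (busemann_product BM) p q ->
  unbounded (busemann_product B1) (pi1 p) (pi1 q).
Proof.
exact: (unbounded_factor (pi := fun a : M => (hval a).1) K1
  (@horo_product_le1 _ _ _ _ _ _ H1 H2)).
Qed.

Let unboundedM2 p q : unbounded (busemann_product BM) p q ->
  unbounded (busemann_product B2) (pi2 p) (pi2 q).
Proof.
exact: (unbounded_factor (pi := fun a : M => (hval a).2) K1
  (@horo_product_le2 _ _ _ _ _ _ H1 H2)).
Qed.

Let eventuallyM p q m : 0 <= m ->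
  eventually_ge (busemann_product B1) (pi1 p) (pi1 q) m ->
  eventually_ge (busemann_product B2) (pi2 p) (pi2 q) m ->
  eventually_ge (busemann_product BM) p q (m - E).
Proof.
move=> m0 [N1 hN1] [N2 hN2]; exists (maxn N1 N2) => k l.
rewrite !geq_max => /andP[k1 k2] /andP[l1 l2].
apply: le_trans (horo_product_ge (hN1 k l k1 l1) (hN2 k l k2 l2)).
by rewrite lerD2r ler_peMl.
Qed.

Let unboundedM p q : unbounded (busemann_product B1) (pi1 p) (pi1 q) ->
  unbounded (busemann_product B2) (pi2 p) (pi2 q) ->
  unbounded (busemann_product BM) p q.
Proof.
move=> pq1 pq2 r; pose m := Num.max 0 (r + E).
have m0 : 0 <= m by rewrite le_max lexx.
have rm : r + E <= m by rewrite le_max lexx orbT.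
by apply: (eventually_ge_le (eventuallyM m0 (pq1 m) (pq2 m))); lra.
Qed.

Lemma horo_point (a : X1) (b : X2) : B1 a = B2 b -> exists p : M, hval p = (a, b).
Proof.
move=> ab; have Yab : horospherical_product B1 B2 (a, b) by [].
by exists (exist _ (a, b) (mem_set Yab)).
Qed.

Lemma horo_center : exists c : nat -> M, centered BM z c.
Proof.
have /choice[c cP] k := horo_point (Bc k).
exists c => r; pose t := Num.max 0 r.
have t0 : 0 <= t by rewrite le_max lexx.
have rt : r <= t by rewrite le_max lexx orbT.
have [N hN] := cc1 (t + mdist z1 (hval z).1 + E).
exists N => k Nk; apply: le_trans rt _; apply: centerM1 => //.
by rewrite cP; exact: hN.
Qed.

(* Of two points at different Busemann heights the one further from the centre is
   moved up to the height of the other. *)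
Lemma horo_lift (x : nat -> X1) (y : nat -> X2) :
  unbounded (busemann_product B1) x x -> unbounded (busemann_product B2) y y ->
  exists2 p : nat -> M, unbounded (busemann_product B1) x (pi1 p) &
    unbounded (busemann_product B2) y (pi2 p).
Proof.
move=> xx yy; pose m k := Num.min (B1 (x k)) (B2 (y k)).
have mx k : 0 <= B1 (x k) - m k by rewrite subr_ge0 /m ge_min lexx.
have my k : 0 <= B2 (y k) - m k by rewrite subr_ge0 /m ge_min lexx orbT.
have /choice[p pP] k : exists p : M, [/\ mdist (x k) (hval p).1 = B1 (x k) - m k,
    mdist (y k) (hval p).2 = B2 (y k) - m k, B1 (hval p).1 = m k & B2 (hval p).2 = m k].
  have [x' xx' Bx'] := horospace_ascending H1 (x k) (mx k).
  have [y' yy' By'] := horospace_ascending H2 (y k) (my k).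
  have [|p pE] := @horo_point x' y'; first by rewrite Bx' By'; lra.
  by exists p; rewrite pE; split=> //=; lra.
(* The product of a point with itself is its value of [B], so [B1] and [B2] tend to infinity along
   [x] and [y]. *)
have mlarge r : exists N, forall k, (N <= k)%N -> r <= m k.
  have [N1 hN1] := xx r; have [N2 hN2] := yy r; exists (maxn N1 N2) => k.
  rewrite geq_max => /andP[k1 k2]; rewrite le_min; apply/andP; split.
    by have := hN1 k k k1 k1; rewrite /busemann_product mdistxx; lra.
  by have := hN2 k k k2 k2; rewrite /busemann_product mdistxx; lra.
exists p => r; have [N hN] := mlarge (r + D).
- have [N1 hN1] := xx (r + D); exists (maxn N N1) => k l.
  rewrite !geq_max => /andP[_ k1] /andP[l0 l1].
  have := hN1 k l k1 l1; have := horo_ultra h1 (x k) (x l) (hval (p l)).1.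
  have -> : busemann_product B1 (x l) (hval (p l)).1 = m l.
    by rewrite /busemann_product; have [-> _ -> _] := pP l; lra.
  by have := hN l l0; lra.
- have [N1 hN1] := yy (r + D); exists (maxn N N1) => k l.
  rewrite !geq_max => /andP[_ k1] /andP[l0 l1].
  have := hN1 k l k1 l1; have := horo_ultra h2 (y k) (y l) (hval (p l)).2.
  have -> : busemann_product B2 (y l) (hval (p l)).2 = m l.
    by rewrite /busemann_product; have [_ -> _ ->] := pP l; lra.
  by have := hN l l0; lra.
Qed.

Section map.
Context (c : nat -> M) (omega : boundary z).
Hypotheses (co : centered BM z c) (oo : represents c omega).

(** The map is first given as a relation, so that any sequence [p] with the right components may be
    used; it is single-valued by [boundary_map_inj]. *)
Definition boundary_map_spec v xi : Prop :=
  if smash_base u1 u2 v then xi = omega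
  else exists p, [/\ represents p xi, represents (pi1 p) v.1 & represents (pi2 p) v.2].

Lemma smash_baseNP v : ~~ smash_base u1 u2 v -> v.1 <> u1 /\ v.2 <> u2.
Proof. by rewrite negb_or => /andP[/eqP ? /eqP]. Qed.

Lemma boundary_map_exists v : exists xi, boundary_map_spec v xi.
Proof.
have [vB|vN] := boolP (smash_base u1 u2 v).
  by exists omega; rewrite /boundary_map_spec vB.
have [v1 v2] := smash_baseNP vN.
have [x xv] := represents_exists v.1; have [y yv] := represents_exists v.2.
have xx := off_center_unbounded D0 h1 cu1 cc1 xv v1.
have yy := off_center_unbounded D0 h2 cu2 cc2 yv v2.
have [p xp yp] := horo_lift xx yy.
have p1 : represents (pi1 p) v.1 := unbounded_represents h1 xv xp.
have p2 : represents (pi2 p) v.2 := unbounded_represents h2 yv yp.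
have pp := unboundedM (off_center_unbounded D0 h1 cu1 cc1 p1 v1)
  (off_center_unbounded D0 h2 cu2 cc2 p2 v2).
have [xi pxi] := boundary_exists (unbounded_busemann_gromov z hM pp).
by exists xi; rewrite /boundary_map_spec (negbTE vN); exists p.
Qed.

Lemma boundary_map_unbounded v w p q : ~~ smash_base u1 u2 v -> v = w ->
  represents (pi1 p) v.1 -> represents (pi2 p) v.2 ->
  represents (pi1 q) w.1 -> represents (pi2 q) w.2 ->
  unbounded (busemann_product BM) p q.
Proof.
move=> /smash_baseNP[v1 v2] <- p1 p2 q1 q2; apply: unboundedM.
  exact: (off_center_equiv D0 h1 cu1 cc1 p1 q1 v1).
exact: (off_center_equiv D0 h2 cu2 cc2 p2 q2 v2).
Qed.

Lemma boundary_map_off v xi p : ~~ smash_base u1 u2 v -> represents p xi ->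
  represents (pi1 p) v.1 -> represents (pi2 p) v.2 -> xi <> omega.
Proof.
move=> vN pxi p1 p2; apply: (unbounded_off_center hM oo co pxi).
exact: (boundary_map_unbounded vN erefl p1 p2 p1 p2).
Qed.

Lemma boundary_map_inj v w xi eta : boundary_map_spec v xi -> boundary_map_spec w eta ->
  xi = eta <-> smash_rel u1 u2 v w.
Proof.
rewrite /boundary_map_spec /=.
case: ifPn => [vB|vN]; case: ifPn => [wB|wN].
- by move=> -> ->; rewrite orbT.
- move=> -> [q [qe q1 q2]]; rewrite orbF; split=> [oe|/eqP vw]; last first.
    by move: wN; rewrite -vw vB.
  by case: (boundary_map_off wN qe q1 q2).
- move=> [p [pxi p1 p2]] ->; rewrite orbF; split=> [oe|/eqP vw]; last first.
    by move: vN; rewrite vw wB.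
  by case: (boundary_map_off vN pxi p1 p2).
- move=> [p [pxi p1 p2]] [q [qe q1 q2]]; rewrite orbF; split=> [xe|/eqP vw].
    have pq := unbounded_gromov_busemann DM0 hM ((representsP gM pxi qe).1 xe).
    have [A _ pA] := off_center hM oo co pxi (boundary_map_off vN pxi p1 p2).
    have {}pq := pq _ pA; apply/eqP.
    rewrite [v]surjective_pairing [w]surjective_pairing; congr (_, _).
      exact: (unbounded_eq h1 p1 q1 (unboundedM1 pq)).
    exact: (unbounded_eq h2 p2 q2 (unboundedM2 pq)).
  apply: (unbounded_eq hM pxi qe).
  exact: (boundary_map_unbounded vN vw p1 p2 q1 q2).
Qed.

Lemma boundary_map_surj xi : exists v, boundary_map_spec v xi.
Proof.
have [xo|xo] := pselect (xi = omega).
  by exists (u1, u2); rewrite /boundary_map_spec /smash_base eqxx.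
have [p pxi] := represents_exists xi.
have pp := off_center_unbounded DM0 hM oo co pxi xo.
have pp1 := unboundedM1 pp; have pp2 := unboundedM2 pp.
have [v1 p1] := boundary_exists (unbounded_busemann_gromov z1 h1 pp1).
have [v2 p2] := boundary_exists (unbounded_busemann_gromov z2 h2 pp2).
exists (v1, v2); rewrite /boundary_map_spec ifF; first by exists p.
apply/negbTE; rewrite negb_or; apply/andP; split; apply/eqP.
  exact: (unbounded_off_center h1 cu1 cc1 p1 pp1).
exact: (unbounded_off_center h2 cu2 cc2 p2 pp2).
Qed.

Lemma boundary_nbhd_omega q eta r t : 0 <= t -> represents q eta ->
  r + DM <= t -> center_ge BM z q t -> boundary_nbhd omega r eta.
Proof.
move=> t0 qe rt qt; apply: (boundary_nbhdI oo qe).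
by apply: (eventually_ge_le (gromov_centered hM co qt)); lra.
Qed.

(** A first coordinate close to [u1] alone forces the sequence of M towards its centre, whatever the
    second coordinate is. *)
Lemma boundary_map_base1 v xi r : boundary_map_spec v xi -> v.1 = u1 ->
  exists2 s : R, 0 < s & forall w eta, boundary_map_spec w eta ->
    boundary_nbhd v.1 s w.1 -> boundary_nbhd xi r eta.
Proof.
have Dge0 := D0.
rewrite /boundary_map_spec /smash_base => + v1; rewrite v1 eqxx/= => ->.
pose t := Num.max 0 (r + DM).
have t0 : 0 <= t by rewrite le_max lexx.
have rt : r + DM <= t by rewrite le_max lexx orbT.
have dz := mdist_ge0 z1 (hval z).1.
exists (t + mdist z1 (hval z).1 + E + 1 + 5 * D + 1); first by lra.
move=> w eta; case: ifPn => [_ -> _|_ [q [qe q1 q2]] vw].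
  exact: boundary_nbhd_refl.
apply: (boundary_nbhd_omega t0 qe rt).
have [N hN] := center_nbhd h1 cu1 cc1 q1 vw; exists N => k Nk.
by apply: centerM1 => //; have := hN k Nk; lra.
Qed.

Lemma boundary_map_base2 v xi r : boundary_map_spec v xi -> v.2 = u2 ->
  exists2 s : R, 0 < s & forall w eta, boundary_map_spec w eta ->
    boundary_nbhd v.2 s w.2 -> boundary_nbhd xi r eta.
Proof.
have Dge0 := D0.
rewrite /boundary_map_spec /smash_base => + v2; rewrite v2 eqxx orbT => ->.
pose t := Num.max 0 (r + DM).
have t0 : 0 <= t by rewrite le_max lexx.
have rt : r + DM <= t by rewrite le_max lexx orbT.
have dz := mdist_ge0 z2 (hval z).2.
exists (t + mdist z2 (hval z).2 + E + 1 + 5 * D + 1); first by lra.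
move=> w eta; case: ifPn => [_ -> _|_ [q [qe q1 q2]] vw].
  exact: boundary_nbhd_refl.
apply: (boundary_nbhd_omega t0 qe rt).
have [N hN] := center_nbhd h2 cu2 cc2 q2 vw; exists N => k Nk.
by apply: centerM2 => //; have := hN k Nk; lra.
Qed.

Lemma boundary_map_off_base v xi r : boundary_map_spec v xi -> ~~ smash_base u1 u2 v ->
  exists2 s : R, 0 < s & forall w eta, boundary_map_spec w eta ->
    boundary_nbhd v.1 s w.1 -> boundary_nbhd v.2 s w.2 -> boundary_nbhd xi r eta.
Proof.
have Dge0 := D0.
rewrite /boundary_map_spec => + vN; rewrite (negbTE vN) => -[p [pxi p1 p2]].
have [v1 v2] := smash_baseNP vN.
have [A1 A10 pA1] := off_center h1 cu1 cc1 p1 v1.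
have [A2 A20 pA2] := off_center h2 cu2 cc2 p2 v2.
(* [E] is the loss in passing from the factors to M, and [BM z] the loss in passing to the product
   based at [z]. *)
pose m := Num.max 0 (r + E + BM z).
have m0 : 0 <= m by rewrite le_max lexx.
have rm : r + E + BM z <= m by rewrite le_max lexx orbT.
have B1n : - B1 z1 <= `|B1 z1| by rewrite ler_normr lexx orbT.
have B2n : - B2 z2 <= `|B2 z2| by rewrite ler_normr lexx orbT.
have N10 := normr_ge0 (B1 z1); have N20 := normr_ge0 (B2 z2).
exists (m + 2 + 5 * D + 2 * A1 + 2 * A2 + `|B1 z1| + `|B2 z2|); first by lra.
move=> w eta hw vw1 vw2.
have wN : ~~ smash_base u1 u2 w.
  have [x xw] := represents_exists w.1; have [y yw] := represents_exists w.2.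
  rewrite negb_or; apply/andP; split; apply/eqP.
    by have [|w1 _] := off_center_nbhd D0 h1 cu1 cc1 p1 xw pA1 vw1 _; [lra|exact: w1].
  by have [|w2 _] := off_center_nbhd D0 h2 cu2 cc2 p2 yw pA2 vw2 _; [lra|exact: w2].
move: hw; rewrite (negbTE wN) => -[q [qe q1 q2]].
have [|_ pq1] := off_center_nbhd D0 h1 cu1 cc1 p1 q1 pA1 vw1 _; first by lra.
have [|_ pq2] := off_center_nbhd D0 h2 cu2 cc2 p2 q2 pA2 vw2 _; first by lra.
apply: (boundary_nbhdI pxi qe).
have {}pq1 : eventually_ge (busemann_product B1) (pi1 p) (pi1 q) m.
  by apply: (eventually_ge_le pq1); lra.
have {}pq2 : eventually_ge (busemann_product B2) (pi2 p) (pi2 q) m.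
  by apply: (eventually_ge_le pq2); lra.
apply: (eventually_ge_le (busemann_gromov z hM (eventuallyM m0 pq1 pq2))).
by lra.
Qed.

Lemma boundary_map_continuous (G : boundary z1 * boundary z2 -> boundary z) :
  (forall v, boundary_map_spec v (G v)) -> continuous G.
Proof.
have g1 := horofunction_gromov h1; have g2 := horofunction_gromov h2.
have DD : 0 <= 2 * D by have := D0; lra.
have DDM : 0 <= 2 * DM by have := D0; lra.
move=> GP v W /(nbhs_boundaryP DDM gM)[r r0 rW].
suff [V1 [V2 [nV1 nV2 V12]]] : exists V1 V2, [/\ nbhs v.1 V1, nbhs v.2 V2 &
    forall w, V1 w.1 -> V2 w.2 -> boundary_nbhd (G v) r (G w)].
  by exists (V1, V2) => // w [/= w1 w2]; apply: rW; exact: V12.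
have [vB|vN] := boolP (smash_base u1 u2 v).
  case/orP: vB => /eqP vu.
    have [s s0 hs] := boundary_map_base1 r (GP v) vu.
    exists (boundary_nbhd v.1 s), setT; split=> [||w w1 _].
    - exact: (nbhs_boundary_nbhd DD g1).
    - exact: filterT.
    - exact: (hs _ _ (GP w) w1).
  have [s s0 hs] := boundary_map_base2 r (GP v) vu.
  exists setT, (boundary_nbhd v.2 s); split=> [||w _ w2].
  - exact: filterT.
  - exact: (nbhs_boundary_nbhd DD g2).
  - exact: (hs _ _ (GP w) w2).
have [s s0 hs] := boundary_map_off_base r (GP v) vN.
exists (boundary_nbhd v.1 s), (boundary_nbhd v.2 s); split=> [||w w1 w2].
- exact: (nbhs_boundary_nbhd DD g1).
- exact: (nbhs_boundary_nbhd DD g2).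
- exact: (hs _ _ (GP w) w1 w2).
Qed.

End map.

Lemma horo_boundary : exists h : boundary z -> smash u1 u2, homeomorphism h.
Proof.
have [c co] := horo_center.
have [omega oo] := boundary_exists (centered_unbounded hM co).
have g1 := horofunction_gromov h1; have g2 := horofunction_gromov h2.
have DD : 0 <= 2 * D by have := D0; lra.
have DDM : 0 <= 2 * DM by have := D0; lra.
have /choice[G GP] := boundary_map_exists omega.
apply: (@smash_homeomorphism _ _ _ _ _ G).
- exact: (boundary_compact DD g1 (horospace_proper H1) (horospace_geodesic H1)).
- exact: (boundary_compact DD g2 (horospace_proper H2) (horospace_geodesic H2)).
- exact: (boundary_hausdorff DDM gM).
- exact: (boundary_map_continuous co oo GP).
(* The chosen value [G v] and [xi] are both related to [v], hence equal. *)
- move=> xi; have [v vxi] := boundary_map_surj co oo xi; exists v.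
  apply/(boundary_map_inj co oo (GP v) vxi).
  by rewrite /= eqxx.
- by move=> v w; exact: (boundary_map_inj co oo (GP v) (GP w)).
Qed.

End boundary_map.

Theorem theorem2 (R : realType) (X1 X2 : metricType R)
    (hX1 : proper_geodesic_hyperbolic X1) (hX2 : proper_geodesic_hyperbolic X2)
    (z1 : X1) (z2 : X2) (u1 : boundary z1) (u2 : boundary z2)
    (B1 : X1 -> R) (B2 : X2 -> R)
    (hB1 : busemann_function u1 B1) (hB2 : busemann_function u2 B2) :
  exists (M : metricType R) (f : M -> X1 * X2),
    [/\ interior_metric_space (horospherical_product B1 B2) f,
        proper_geodesic_hyperbolic M &
        forall z : M, exists h : boundary z -> smash u1 u2, homeomorphism h].
Proof.
have [D1 H1] := busemann_horospace hX1 hB1; have [D2 H2] := busemann_horospace hX2 hB2.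
have {}H1 : horospace B1 (Num.max D1 D2) by apply: H1; rewrite le_max lexx.
have {}H2 : horospace B2 (Num.max D1 D2) by apply: H2; rewrite le_max lexx orbT.
have [c1 [cu1 cc1 Bc1]] := busemann_centered hB1.
have [c2 [cu2 cc2 Bc2]] := busemann_centered hB2.
exists (horo_prod H1 H2), (@hval _ _ _ _ _ _ H1 H2); split.
- exact: interior_metric_horo_prod.
- exact: horo_hyperbolic.
- by move=> z; apply: (horo_boundary z cu1 cu2 cc1 cc2) => k; rewrite Bc1 Bc2.
Qed.
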